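(* Let $n,k,t$ be integers with $2\le t<k$. If $$n\ge (t+1)(k-t+1)+\left\lceil (t+1)\log(t+1)\right\rceil,$$ then the full $t$-star is spectrally extremal among the $t$-intersecting subfamilies of $\binom{[n]}{k}$, and it is the unique spectrally extremal family up to permutation.
   Context: Notation: $\log$ is the natural logarithm; $[n]=\{1,\dots,n\}$, and $\binom{X}{k}$ is the collection of $k$-element subsets of $X$. A family $\mathcal F\subseteq\binom{[n]}{k}$ is $t$-intersecting if $|F\cap F'|\ge t$ for all $F,F'\in\mathcal F$. For $\mathcal F\subseteq\binom{[n]}{k}$ and $x\in\mathbb R_{\ge0}^n$ put $P_{\mathcal F}(x)=k\sum_{F\in\mathcal F}\prod_{i\in F}x_i$ and $\rho(\mathcal F)=\max\{P_{\mathcal F}(x):x\ge0,\ \sum_i x_i^k=1\}$ (the spectral radius). A $t$-intersecting family is spectrally extremal if its $\rho$ is largest among all $t$-intersecting subfamilies of $\binom{[n]}{k}$. The full $t$-star is $\{F\in\binom{[n]}{k}:[t]\subseteq F\}$ (or any image of it under a permutation of $[n]$). ''Up to permutation'' means up to applying a permutation of the ground set $[n]$. *)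

(* Defs.v *)
From HB Require Import structures.
From mathcomp Require Import all_boot all_order all_algebra all_fingroup.
From mathcomp Require Import all_classical all_reals all_analysis.
Set Implicit Arguments.
Unset Strict Implicit.
Unset Printing Implicit Defensive.
Import Order.TTheory GRing.Theory Num.Theory.
Import numFieldNormedType.Exports.
Local Open Scope ring_scope.

(* The ground set [n] is 'I_n = {0, ..., n - 1}, so [t] becomes the set of    *)
(* the i : 'I_n with i < t.                                                   *)

Definition k_uniform (n k : nat) (F : {set {set 'I_n}}) : Prop :=
  {in F, forall A : {set 'I_n}, #|A| = k}.

Definition t_intersecting (n t : nat) (F : {set {set 'I_n}}) : Prop :=
  {in F &, forall A B : {set 'I_n}, (t <= #|A :&: B|)%N}.

Definition full_star (n k t : nat) : {set {set 'I_n}} :=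
  [set A : {set 'I_n} | (#|A| == k) && ([set i : 'I_n | (i < t)%N] \subset A)]%SET.

Definition permute_family (n : nat) (s : {perm 'I_n}) (F : {set {set 'I_n}}) :
    {set {set 'I_n}} :=
  [set (s @: (A : {set 'I_n}))%SET | A : {set 'I_n} in F]%SET.

Definition family_poly (R : realType) (n k : nat) (F : {set {set 'I_n}})
    (x : 'rV[R]_n) : R :=
  k%:R * \sum_(A in F) \prod_(i in A) x ord0 i.

Definition unit_weights (R : realType) (n k : nat) : set 'rV[R]_n :=
  [set x | (forall i, 0 <= x ord0 i) /\ \sum_i x ord0 i ^+ k = 1]%classic.

Arguments unit_weights : clear implicits.

(* The supremum is a maximum as soon as 0 < n and 0 < k: see [rho_max].       *)
Definition rho (R : realType) (n k : nat) (F : {set {set 'I_n}}) : R :=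
  sup [set family_poly k F x | x in unit_weights R n k]%classic.

Definition spectrally_extremal (R : realType) (n k t : nat)
    (F : {set {set 'I_n}}) : Prop :=
  [/\ k_uniform k F, t_intersecting t F &
      forall G : {set {set 'I_n}}, k_uniform k G -> t_intersecting t G ->
        rho R k G <= rho R k F].

Lemma unit_weights_neq0 (R : realType) (n k : nat) :
  (0 < n)%N -> (0 < k)%N -> (unit_weights R n k !=set0)%classic.
Proof.
move=> n0 k0; pose i0 := Ordinal n0.
exists (\row_i (i == i0)%:R); split=> [i|]; first by rewrite mxE ler0n.
rewrite (bigD1 i0) //= big1 ?mxE ?eqxx ?expr1n ?addr0 // => i /negPf ni.
by rewrite mxE ni expr0n eqn0Ngt k0.
Qed.

Lemma unit_weights_compact (R : realType) (n k : nat) :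
  (0 < k)%N -> compact (unit_weights R n k).
Proof.
move=> k0.
have cube := @rV_compact R n (fun=> `[0, 1]%classic)
  (fun=> @segment_compact R 0 1).
apply: (subclosed_compact _ cube); last first.
  move=> x [x0 x1] i /=; rewrite in_itv/= x0/=.
  rewrite -(@ler_pXn2r _ k) ?nnegrE // expr1n -x1 (bigD1 i) //= lerDl.
  by apply: sumr_ge0 => j _; exact: exprn_ge0.
have -> : unit_weights R n k =
  ((\bigcap_(i in [set: 'I_n]) ((fun x : 'rV[R]_n => x ord0 i) @^-1` [set y | 0 <= y]))
  `&` ((fun x : 'rV[R]_n => \sum_i x ord0 i ^+ k) @^-1` [set 1]))%classic.
  apply/seteqP; split=> x /= [h1 h2]; split=> //; first by move=> i _; exact: h1.
  by move=> i; exact: h1.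
apply: closedI.
  apply: closed_bigI => i _; have /continuous_closedP := @coord_continuous R 1 n ord0 i.
  by apply; exact: closed_ge.
have /continuous_closedP : continuous (fun x : 'rV[R]_n => \sum_i x ord0 i ^+ k).
  apply: continuous_big => [|i _ x]; first exact: add_continuous.
  apply: (@continuous_comp _ _ _ (fun x : 'rV[R]_n => x ord0 i) (fun y : R => y ^+ k)).
    exact: coord_continuous.
  exact: exprn_continuous.
by apply; exact: closed_eq.
Qed.

Lemma family_poly_continuous (R : realType) (n k : nat) (F : {set {set 'I_n}}) :
  continuous (@family_poly R n k F).
Proof.
have cS : continuous (fun x : 'rV[R]_n => \sum_(A in F) \prod_(i in A) x ord0 i).
  apply: continuous_big => [|A _]; first exact: add_continuous.
  apply: continuous_big => [|i _]; first exact: mul_continuous.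
  exact: coord_continuous.
by move=> x; apply: (cvgM (cvg_cst _) (cS x)).
Qed.

Lemma rho_max (R : realType) (n k : nat) (F : {set {set 'I_n}}) :
  (0 < n)%N -> (0 < k)%N ->
  (exists2 x, unit_weights R n k x & family_poly k F x = rho R k F) /\
  (forall x, unit_weights R n k x -> family_poly k F x <= rho R k F).
Proof.
move=> n0 k0.
have [c] := compact_EVT_max (@unit_weights_neq0 R n k n0 k0)
  (@unit_weights_compact R n k k0)
  (continuous_subspaceT (@family_poly_continuous R n k F)).
rewrite inE => Wc cmax.
have max_c x : unit_weights R n k x -> family_poly k F x <= family_poly k F c.
  by move=> Wx; apply: cmax; rewrite inE.
have rhoE : rho R k F = family_poly k F c.
  apply/eqP; rewrite eq_le; apply/andP; split.
    by apply: ge_sup; [exists (family_poly k F c), c|move=> _ [x Wx <-]; exact: max_c].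
  apply: ub_le_sup; last by exists c.
  by exists (family_poly k F c) => _ [x Wx <-]; exact: max_c.
by split=> [|x Wx]; [exists c|rewrite rhoE; exact: max_c].
Qed.

(* Main.v *)
Require Import Defs.
From mathcomp Require Import all_boot all_order all_algebra all_fingroup.
From mathcomp Require Import all_classical all_reals all_analysis.
From mathcomp Require Import ring lra zify.
Import Order.TTheory GRing.Theory Num.Theory.
Local Open Scope ring_scope.
Set Implicit Arguments.
Unset Strict Implicit.
Unset Printing Implicit Defensive.

(* Sort the weights decreasingly and treat a family through its traces on [m], for m going
   down from n to t: the points below m carry weights x_0 >= x_1 >= ..., all later points a
   common weight b <= x_(m-1), and a trace of size d stands for its C(n - m, k - d)
   completions.  To pass from m + 1 to m, compress the traces within [m + 1] and replace both
   x_m and b by their k-th power mean w.  A trace D avoiding m is kept.  If only D with m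
   added was a trace, put D instead: this destroys the t-intersection property only for pairs
   D, D' covering [m] with |D| + |D'| = m + t - 1, so from each pair of complementary size
   classes the one of smaller new value is dropped, and in the middle class one keeps the D
   avoiding a suitable point (averaging).  By AM-GM the old value of a class is at most r
   times its new value, where r^k = ((k - d) / (n - m))^(k - 1), and the bound on n makes
   r < 1/(t + 1) for the middle class and r + r' < 1 for the others, so nothing is lost.  At
   m = t only the star is left, and AM-GM gives its optimal weights.  If no step loses, every
   trace that was dropped was void, which forces the family to be the star. *)

(** * Tangent-line and power-mean inequalities *)

(** Convexity without derivatives: multiplying the inequality for one exponent by [y] leaves the
    surplus [c.+1 z^c (y - z)^2]. *)
Lemma exprS_tangent (R : realDomainType) (y z : R) (c : nat) : 0 <= y -> 0 <= z ->
  z ^+ c.+1 + c.+1%:R * z ^+ c * (y - z) <= y ^+ c.+1.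
Proof.
move=> y0 z0; elim: c => [|c IH]; first by rewrite !expr1 expr0; lra.
have zc : 0 <= z ^+ c by exact: exprn_ge0.
have := ler_wpM2l y0 IH; rewrite -exprS; apply: le_trans.
rewrite -subr_ge0 !exprS -[c.+2]addn1 natrD.
set w := z ^+ c in zc *; set a := c.+1%:R.
have -> : y * (z * w + a * w * (y - z)) -
  (z * (z * w) + (a + 1%:R) * (z * w) * (y - z)) = a * w * (y - z) ^+ 2.
  by rewrite expr2; ring.
by rewrite mulr_ge0 ?sqr_ge0 // mulr_ge0 ?ler0n.
Qed.

(** Strictness starts at exponent 2, since at exponent 1 the tangent is the function itself. It
    feeds the equality cases. *)
Lemma exprS_tangent_lt (R : realDomainType) (y z : R) (c : nat) : 0 <= z -> z < y ->
  z ^+ c.+2 + c.+2%:R * z ^+ c.+1 * (y - z) < y ^+ c.+2.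
Proof.
move=> z0 zy; have y0 : 0 < y by exact: le_lt_trans zy.
elim: c => [|c IH].
  rewrite -subr_gt0 !expr2 expr1.
  have -> : y * y - (z * z + 2%:R * z * (y - z)) = (y - z) * (y - z) by ring.
  by rewrite mulr_gt0 ?subr_gt0.
have zc : 0 <= z ^+ c.+1 by exact: exprn_ge0.
have : y * (z ^+ c.+2 + c.+2%:R * z ^+ c.+1 * (y - z)) < y * y ^+ c.+2.
  by rewrite ltr_pM2l.
rewrite -(exprS y); apply: le_lt_trans.
rewrite -subr_ge0 [z ^+ c.+3]exprS [z ^+ c.+2]exprS -[c.+3]addn1 natrD.
set w := z ^+ c.+1 in zc *; set a := c.+2%:R.
have -> : y * (z * w + a * w * (y - z)) -
  (z * (z * w) + (a + 1%:R) * (z * w) * (y - z)) = a * w * (y - z) ^+ 2.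
  by rewrite expr2; ring.
by rewrite mulr_ge0 ?sqr_ge0 // mulr_ge0 ?ler0n.
Qed.

(** The tangent of [y ^+ c.+1] at [s], evaluated at the mean of [p] and [N] copies of [s], exceeds
    the left side by [(N - c) s ^+ c.+1 / (N + 1)]. *)
Lemma weighted_mean_bound (R : realFieldType) (c N : nat) (p s : R) :
  (c <= N)%N -> 0 <= p -> 0 <= s ->
  c.+1%:R / N.+1%:R * (p * s ^+ c) <= ((p + N%:R * s) / N.+1%:R) ^+ c.+1.
Proof.
move=> cN p0 s0; have N0 : (0 : R) < N.+1%:R by rewrite ltr0n.
set y := (p + N%:R * s) / N.+1%:R.
have y0 : 0 <= y by rewrite divr_ge0 ?addr_ge0 ?mulr_ge0 ?ler0n // ltW.
have := exprS_tangent c y0 s0; apply: le_trans.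
have sc : 0 <= s ^+ c by exact: exprn_ge0.
rewrite exprS -subr_ge0 /y -[N.+1]addn1 -[c.+1]addn1 !natrD.
set w := s ^+ c in sc *.
have N1 : (N%:R : R) + 1 != 0 by rewrite -natr1 in N0; lra.
have -> : s * w + (c%:R + 1%:R) * w * ((p + N%:R * s) / (N%:R + 1%:R) - s) -
   (c%:R + 1%:R) / (N%:R + 1%:R) * (p * w) =
   (N%:R - c%:R) * (s * w) / (N%:R + 1%:R) by field.
have cN' : (c%:R : R) <= N%:R by rewrite ler_nat.
by rewrite divr_ge0 ?mulr_ge0 ?subr_ge0 ?addr_ge0 ?ler0n.
Qed.

(** Tangents at the arithmetic mean [m], taken once at [y] and [N] times at [z], add up with
    cancelling linear terms. *)
Lemma power_mean (R : realFieldType) (k N : nat) (y z w : R) :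
  0 <= y -> 0 <= z -> 0 <= w -> w ^+ k.+1 = (y ^+ k.+1 + N%:R * z ^+ k.+1) / N.+1%:R ->
  (y + N%:R * z) / N.+1%:R <= w.
Proof.
move=> y0 z0 w0 wE; have N0 : (0 : R) < N.+1%:R by rewrite ltr0n.
set m := (y + N%:R * z) / N.+1%:R.
have m0 : 0 <= m by rewrite divr_ge0 ?addr_ge0 ?mulr_ge0 ?ler0n // ltW.
rewrite -(@ler_pXn2r _ k.+1) ?nnegrE // wE ler_pdivlMr //.
have Hy := exprS_tangent k y0 m0.
have Hz := ler_wpM2l (ler0n R N) (exprS_tangent k z0 m0).
apply: le_trans (lerD Hy Hz).
have : m * N.+1%:R = y + N%:R * z by rewrite divfK // gt_eqF.
rewrite -[N.+1]addn1 natrD => mE; rewrite le_eqVlt; apply/orP; left; apply/eqP.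
set a := m ^+ k.+1; set b := m ^+ k.
transitivity (a + N%:R * a + k.+1%:R * b * (y + N%:R * z - m * (N%:R + 1))); last by ring.
by rewrite -mE; ring.
Qed.

Lemma power_mean_lt (R : realFieldType) (k N : nat) (y z w : R) :
  0 <= z -> 0 <= w -> z < y -> w ^+ k.+2 = (y ^+ k.+2 + N.+1%:R * z ^+ k.+2) / N.+2%:R ->
  (y + N.+1%:R * z) / N.+2%:R < w.
Proof.
move=> z0 w0 zy wE; have N0 : (0 : R) < N.+2%:R by rewrite ltr0n.
have y0 : 0 < y by exact: le_lt_trans zy.
set m := (y + N.+1%:R * z) / N.+2%:R.
have m0 : 0 <= m.
  by rewrite divr_ge0 ?addr_ge0 ?mulr_ge0 ?ler0n // ltW.
have my : m < y.
  rewrite ltr_pdivrMr // -[in ltRHS]natr1 mulrDr mulr1 addrC ltrD2r mulrC.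
  by rewrite ltr_pM2r ?ltr0n.
rewrite -(@ltr_pXn2r _ k.+2) ?nnegrE // wE ltr_pdivlMr //.
have Hy := exprS_tangent_lt k m0 my.
have Hz := ler_wpM2l (ler0n R N.+1) (exprS_tangent k.+1 z0 m0).
apply: le_lt_trans (ltr_leD Hy Hz).
have : m * N.+2%:R = y + N.+1%:R * z by rewrite divfK // gt_eqF.
rewrite -[N.+2]addn1 natrD => mE; rewrite le_eqVlt; apply/orP; left; apply/eqP.
set a := m ^+ k.+2; set b := m ^+ k.+1; set d := N.+1%:R in mE *.
transitivity (a + d * a + k.+2%:R * b * (y + d * z - m * (d + 1))); last by ring.
by rewrite -mE; ring.
Qed.

(** * Numerical estimates for exponentials and logarithms *)

Lemma exprD1_ge_quad (R : realFieldType) (y : R) (K : nat) : 0 <= y ->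
  1 + K%:R * y + K%:R * (K%:R - 1) / 2 * y ^+ 2 <= (1 + y) ^+ K.
Proof.
move=> y0; elim: K => [|K IH]; first by rewrite expr0; lra.
have y1 : 0 <= 1 + y by lra.
have := ler_wpM2l y1 IH; rewrite -exprS; apply: le_trans.
rewrite -subr_ge0 -[K.+1]addn1 natrD.
have K0 : (0 : R) <= K%:R * (K%:R - 1).
  by case: K {IH} => [|K]; [lra|rewrite mulr_ge0 ?ler0n // subr_ge0 ler1n].
have -> : (1 + y) * (1 + K%:R * y + K%:R * (K%:R - 1) / 2 * y ^+ 2) -
  (1 + (K%:R + 1%:R) * y + (K%:R + 1%:R) * (K%:R + 1%:R - 1) / 2 * y ^+ 2) =
  (K%:R * (K%:R - 1)) * y ^+ 3 / 2 by field.
by rewrite divr_ge0 // mulr_ge0 // exprn_ge0.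
Qed.

(** From [exp (-1/6) >= 5/6] one gets [e <= (6/5)^6 = 2.985984]. *)
Lemma expR1_lt3 (R : realType) : expR 1 < 3 :> R.
Proof.
have H : (5 / 6 : R) <= expR (- (1 / 6)).
  by apply: le_trans (expR_ge1Dx _); lra.
have H6 : expR (1 / 6) <= 6 / 5 :> R.
  rewrite -[X in expR X]opprK expRN -[leRHS]invrK lef_pV2 ?posrE ?expR_gt0 //; lra.
have -> : (1 : R) = 6%:R * (1 / 6) by field.
rewrite expRM_natl; apply: (@le_lt_trans _ _ ((6 / 5) ^+ 6)); last by lra.
by rewrite ler_pXn2r ?nnegrE ?expR_ge0 //; lra.
Qed.

(** [t + 1 <= 2 ^ (t - 1) < exp (t - 1)]; the first inequality is tight at [t = 3]. *)
Lemma ln_succ_lt (R : realType) (t : nat) : (3 <= t)%N -> ln (t + 1)%:R < t%:R - 1 :> R.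
Proof.
move=> t3.
have e2 : 2 < expR 1 :> R.
  have H : (3 / 2 : R) <= expR (1 / 2) by apply: le_trans (expR_ge1Dx _); lra.
  have -> : (1 : R) = 2%:R * (1 / 2) by field.
  rewrite expRM_natl; apply: (@lt_le_trans _ _ ((3 / 2) ^+ 2)); first by lra.
  by rewrite ler_pXn2r ?nnegrE ?expR_ge0 //; lra.
rewrite -ltr_expR lnK ?posrE ?ltr0n ?addn1 //.
have -> : t%:R - 1 = t.-1%:R * 1 :> R by rewrite mulr1 -subn1 natrB // (leq_trans _ t3).
rewrite expRM_natl; apply: (@le_lt_trans _ _ (2 ^+ t.-1)).
  rewrite -natrX ler_nat; case: t t3 => [//|t] /=.
  by elim: t => [//|[|[|t]] IH] // _; rewrite expnS; have := IH isT; lia.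
by rewrite ltr_pXn2r ?nnegrE ?expR_ge0 //; lia.
Qed.

(* For [t >= 3] this is [1 + v >= exp (v / (1 + v))] with [v = ln (t + 1) / (k - t)]; for
   [t = 2] that is too weak and one uses instead that [M] is an integer above [3 c + 3]. *)
Lemma star_ratio_bound (R : realType) (k t c M : nat) :
  (2 <= t)%N -> (t < k)%N -> (0 < c)%N -> (c <= k - t)%N ->
  (t + 1)%:R * c%:R + (t + 1)%:R * ln (t + 1)%:R <= M%:R :> R ->
  (t + 1)%:R ^+ k * c%:R ^+ k.-1 < M%:R ^+ k.-1 :> R.
Proof.
move=> t2 tk c0 ck hM.
have kE : k = k.-1.+1 by rewrite prednK // (leq_trans _ tk).
have t0 : (0 : R) < (t + 1)%:R by rewrite ltr0n addn1.
have c0' : (0 : R) < c%:R by rewrite ltr0n.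
(* The factor [(1 + v) ^ (k - 1)] is to absorb the one surplus factor [t + 1] on the left. *)
suff [v v0 [vM hv]] : exists2 v : R, 0 <= v &
    (t + 1)%:R * (1 + v) * c%:R <= M%:R /\ (t + 1)%:R < (1 + v) ^+ k.-1.
  apply: (@lt_le_trans _ _ (((t + 1)%:R * (1 + v) * c%:R) ^+ k.-1)).
    rewrite !exprMn ltr_pM2r ?exprn_gt0 // {1}kE exprS mulrC.
    by rewrite ltr_pM2l ?exprn_gt0.
  by apply: lerXn2r; rewrite ?nnegrE ?ler0n // !mulr_ge0 ?ler0n // addr_ge0.
have kt0 : (0 : R) < (k - t)%:R by rewrite ltr0n subn_gt0.
have ckR : c%:R <= (k - t)%:R :> R by rewrite ler_nat.
have ckt : c%:R / (k - t)%:R <= 1 :> R by rewrite ler_pdivrMr ?mul1r.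
have [t3|] := leqP 3 t; last first.
  rewrite ltnS => t3; have {t3}t2E : t = 2%N by apply/eqP; rewrite eqn_leq t3.
  subst t; have hM4 : (3 * c + 4 <= M)%N.
    rewrite addnS -(ltr_nat R) natrD natrM; apply: lt_le_trans hM.
    rewrite (_ : (2 + 1)%N = 3) // ltrD2l.
    suff : 1 < ln 3%:R :> R by lra.
    by rewrite -ltr_expR lnK ?posrE ?ltr0n //; exact: expR1_lt3.
  (* The largest [v] with [3 (1 + v) c <= 3 c + 4] for all [c <= k - 2]. *)
  exists (4 / (3 * (k - 2)%:R)); first by rewrite divr_ge0 ?mulr_ge0 // ltW.
  split.
    apply: (@le_trans _ _ (3 * c + 4)%:R); last by rewrite ler_nat.
    rewrite (_ : (2 + 1)%N = 3) // natrD natrM.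
    have -> : 3%:R * (1 + 4 / (3 * (k - 2)%:R)) * c%:R =
      3%:R * c%:R + 4 * (c%:R / (k - 2)%:R) :> R by field; rewrite gt_eqF.
    lra.
  set y := 4 / _.
  have y0 : 0 < y by rewrite divr_gt0 ?mulr_gt0 // ltr0n.
  (* Since [(k - 2) y = 4/3], the terms up to degree 2 exceed [1 + 4/3 + 8/9 > 3]. *)
  have := exprD1_ge_quad k.-1 (ltW y0); apply: lt_le_trans.
  have -> : k.-1%:R = (k - 2)%:R + 1 :> R.
    by rewrite natr1; congr (_%:R); lia.
  have hy : (k - 2)%:R * y = 4 / 3 by rewrite /y; field; rewrite gt_eqF.
  have -> : 1 + ((k - 2)%:R + 1) * y +
     ((k - 2)%:R + 1) * ((k - 2)%:R + 1 - 1) / 2 * y ^+ 2 =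
    1 + (k - 2)%:R * y + y + ((k - 2)%:R * y) * ((k - 2)%:R * y + y) / 2 by field.
  rewrite hy (_ : (2 + 1)%N = 3) //; lra.
set l := ln (t + 1)%:R in hM.
have l0 : 0 < l by rewrite ln_gt0 // ltr1n addn1 ltnS (leq_trans _ t2).
have lt : l < t%:R - 1 by exact: ln_succ_lt.
exists (l / (k - t)%:R); first by rewrite divr_ge0 // ltW.
split.
  apply: le_trans hM.
  have -> : (t + 1)%:R * (1 + l / (k - t)%:R) * c%:R =
    (t + 1)%:R * c%:R + (t + 1)%:R * l * (c%:R / (k - t)%:R) :> R.
    by field; rewrite gt_eqF.
  by rewrite lerD2l ler_piMr // mulr_ge0 // ltW.
set v := l / _; have v0 : 0 < v by rewrite divr_gt0.
have hv : expR (v / (1 + v)) <= 1 + v.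
  have v1 : 0 < 1 + v by rewrite addr_gt0.
  have := expR_ge1Dx (- (v / (1 + v))); rewrite expRN.
  have -> : 1 - v / (1 + v) = (1 + v)^-1 by field; rewrite gt_eqF.
  by rewrite lef_pV2 // posrE ?expR_gt0.
have hp : expR (v / (1 + v)) ^+ k.-1 <= (1 + v) ^+ k.-1.
  apply: lerXn2r hv; first by rewrite nnegrE expR_ge0.
  by rewrite nnegrE addr_ge0 // ltW.
apply: lt_le_trans hp.
rewrite -expRM_natl -[ltLHS]lnK ?posrE // ltr_expR -/l.
(* With this splitting, [(k - 1) v / (1 + v) > l] amounts to [l < t - 1]. *)
have -> : k.-1%:R = (k - t)%:R + (t%:R - 1) :> R.
  rewrite -subn1 -[X in _ + (_ - X)]/(1%:R) -natrB ?(leq_trans _ t2) // -natrD.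
  by congr (_%:R); lia.
have -> : v / (1 + v) = l / ((k - t)%:R + l).
  by rewrite /v; field; rewrite !gt_eqF // addr_gt0.
rewrite mulrA ltr_pdivlMr ?addr_gt0 //.
by rewrite mulrC ltr_pM2r //; lra.
Qed.

(** * Weights of completions and the effect of merging points *)

(* The weight of completing a trace of size [d] to size [k] by points of weight [b] chosen among
   [N]; the test is needed because [k - d] is truncated. *)
Definition tailw (R : realFieldType) (k N : nat) (b : R) (d : nat) : R :=
  if (d <= k)%N then b ^+ (k - d) * 'C(N, k - d)%:R else 0.

Lemma tailw_ge0 (R : realFieldType) (k N : nat) (b : R) (d : nat) :
  0 <= b -> 0 <= tailw k N b d.
Proof. by move=> b0; rewrite /tailw; case: ifP => // _; rewrite mulr_ge0 ?exprn_ge0. Qed.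

Lemma tailw_gt0 (R : realFieldType) (k N : nat) (b : R) (d : nat) :
  (d <= k)%N -> (k <= d + N)%N -> ((0 < N)%N -> 0 < b) -> 0 < tailw k N b d.
Proof.
move=> dk kN b0; rewrite /tailw dk mulr_gt0 ?ltr0n ?bin_gt0 ?leq_subLR //.
case: N kN b0 => [|N] kN b0; last by rewrite exprn_gt0 ?b0.
by rewrite (_ : (k - d)%N = 0%N) ?expr0 //; lia.
Qed.

Lemma tailw_eq0 (R : realFieldType) (k N : nat) (b : R) (d : nat) :
  ~~ (d <= k <= d + N)%N -> tailw k N b d = 0.
Proof.
rewrite /tailw; case: leqP => //= dk; rewrite -ltnNge => kd.
by rewrite bin_small ?mulr0 //; lia.
Qed.

Lemma bin_ratio (R : realFieldType) (N c : nat) :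
  'C(N, c)%:R = c.+1%:R / N.+1%:R * 'C(N.+1, c.+1)%:R :> R.
Proof.
have := congr1 (fun m : nat => m%:R : R) (mul_bin_diag N.+1 c); rewrite /= !natrM => h.
by apply: (mulfI (x := N.+1%:R)); rewrite ?pnatr_eq0 // h mulrA mulrCA divff ?pnatr_eq0 ?mulr1.
Qed.

(** A completion either avoids or uses one chosen outside point. *)
Lemma tailw_pascal (R : realFieldType) (k N : nat) (b : R) (d : nat) :
  tailw k N.+1 b d = tailw k N b d + b * tailw k N b d.+1.
Proof.
rewrite /tailw; case: (ltngtP d k) => [dk||->]; last 2 first.
- by rewrite mulr0 addr0.
- by rewrite subnn !bin0 mulr0 addr0.
have -> : (k - d = (k - d.+1).+1)%N by lia.
by rewrite binS natrD exprS; ring.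
Qed.

(** With the binomial coefficient factored out, what remains is the tangent of [z ^+ (k - d)] at
    [b], evaluated at the mean of [y] and [N] copies of [b]; [exprS_tangent] applies to this
    form. *)
Lemma tailwE (R : realFieldType) (k N d : nat) (b y : R) : (d < k)%N ->
  tailw k N b d + y * tailw k N b d.+1 =
  'C(N.+1, k - d)%:R * (b ^+ (k - d) +
     (k - d)%:R * b ^+ (k - d.+1) * ((y + N%:R * b) / N.+1%:R - b)).
Proof.
move=> dk; rewrite /tailw dk ltnW //.
have -> : (k - d = (k - d.+1).+1)%N by lia.
set c := (k - d.+1)%N.
have hC : 'C(N, c.+1)%:R = 'C(N.+1, c.+1)%:R - 'C(N, c)%:R :> R.
  by rewrite binS natrD; ring.
rewrite hC bin_ratio; set C := 'C(N.+1, _)%:R.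
have N1 : (N%:R : R) + 1 != 0 by rewrite natr1 pnatr_eq0.
by rewrite exprS -[N.+1]addn1 natrD; field.
Qed.

(** By [tailwE] the left side is a tangent value, so at most a power of the arithmetic mean, which
    is at most the power mean [w]. For [d = k] both sides are 1, for [d > k] both are 0. *)
Lemma tailw_merge (R : realFieldType) (k N d : nat) (b y w : R) :
  (0 < k)%N -> 0 <= b -> 0 <= y -> 0 <= w ->
  w ^+ k = (y ^+ k + N%:R * b ^+ k) / N.+1%:R ->
  tailw k N b d + y * tailw k N b d.+1 <= tailw k N.+1 w d.
Proof.
move=> k0 b0 y0 w0 wE; case: (ltngtP d k) => [dk|dk|->]; last 2 first.
- have [h1 h2] : (d <= k)%N = false /\ (d < k)%N = false by lia.
  by rewrite /tailw h1 h2 mulr0 addr0.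
- by rewrite /tailw ltnn leqnn subnn !bin0 !expr0 mulr0 addr0.
rewrite tailwE // /tailw ltnW // mulrC ler_wpM2r ?ler0n //.
set m := (y + N%:R * b) / N.+1%:R.
have m0 : 0 <= m by rewrite divr_ge0 // addr_ge0 // mulr_ge0.
have mw : m <= w by case: k k0 wE {dk} => [//|k] _; exact: power_mean.
have -> : (k - d = (k - d.+1).+1)%N by lia.
apply: le_trans (exprS_tangent _ m0 b0) _.
by apply: lerXn2r mw; rewrite nnegrE.
Qed.

(** At least two points are merged and their weights differ, so the power mean strictly exceeds the
    arithmetic one; the condition on [d] makes the exponent and the binomial coefficient
    positive. *)
Lemma tailw_merge_lt (R : realFieldType) (k N d : nat) (b y w : R) :
  (1 < k)%N -> 0 <= b -> b < y -> 0 <= w ->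
  w ^+ k = (y ^+ k + N.+1%:R * b ^+ k) / N.+2%:R ->
  (d < k <= d + N.+2)%N ->
  tailw k N.+1 b d + y * tailw k N.+1 b d.+1 < tailw k N.+2 w d.
Proof.
move=> k0 b0 by_ w0 wE /andP[dk kd].
have y0 : 0 <= y by rewrite ltW // (le_lt_trans b0).
rewrite tailwE // /tailw ltnW // mulrC ltr_pM2r ?ltr0n ?bin_gt0 ?leq_subLR //.
set m := (y + N.+1%:R * b) / N.+2%:R.
have m0 : 0 <= m by rewrite divr_ge0 // addr_ge0 // mulr_ge0.
have mw : m < w by case: k k0 wE {dk kd} => [//|[//|k]] _; exact: power_mean_lt.
have -> : (k - d = (k - d.+1).+1)%N by lia.
apply: le_lt_trans (exprS_tangent _ m0 b0) _.
by rewrite ltrXn2r // nnegrE.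
Qed.

(* AM-GM: with p = y^k, s = b^k and c = k - d, [c / (N + 1) * p s^(c - 1) <= (w^k)^c]. *)
Lemma tailw_drop (R : realFieldType) (k N d : nat) (b y w r : R) :
  0 <= b -> 0 <= y -> 0 <= w -> 0 <= r ->
  w ^+ k = (y ^+ k + N%:R * b ^+ k) / N.+1%:R ->
  (d < k <= d + N.+1)%N ->
  ((k - d)%:R / N.+1%:R) ^+ k.-1 <= r ^+ k ->
  y * tailw k N b d.+1 <= r * tailw k N.+1 w d.
Proof.
move=> b0 y0 w0 r0 wE /andP[dk kd] hr; rewrite /tailw dk ltnW //.
have -> : (k - d = (k - d.+1).+1)%N by lia.
have cN : (k - d.+1 <= N)%N by lia.
have cE : (k - d = (k - d.+1).+1)%N by lia.
move: hr; rewrite cE; set c := (k - d.+1)%N in cN *.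
rewrite bin_ratio; set q : R := c.+1%:R / N.+1%:R => hr.
have q0 : 0 <= q by rewrite divr_ge0.
set C := 'C(_, _)%:R.
have -> : y * (b ^+ c * (q * C)) = q * (y * b ^+ c) * C by ring.
rewrite [leRHS]mulrA ler_wpM2r ?ler0n //.
have k0 : (0 < k)%N by exact: leq_ltn_trans dk.
rewrite -(@ler_pXn2r _ k) // ?nnegrE ?mulr_ge0 ?exprn_ge0 //.
rewrite [(q * _) ^+ k]exprMn [(y * _) ^+ k]exprMn [(r * _) ^+ k]exprMn.
rewrite -!exprM [(c * k)%N]mulnC [(c.+1 * k)%N]mulnC !exprM wE.
have hw := weighted_mean_bound cN (exprn_ge0 k y0) (exprn_ge0 k b0).
have -> : q ^+ k = q ^+ k.-1 * q by rewrite -exprSr prednK.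
rewrite -mulrA; apply: le_trans (ler_wpM2l (exprn_ge0 _ q0) hw) _.
by rewrite ler_wpM2r // exprn_ge0 // divr_ge0 // addr_ge0 ?mulr_ge0 ?exprn_ge0.
Qed.

Lemma powR_invK (R : realType) (k : nat) (z : R) : (0 < k)%N -> 0 <= z ->
  (z `^ (k%:R^-1)) ^+ k = z.
Proof.
move=> k0 z0.
by rewrite -powR_mulrn ?powR_ge0 // -powRrM mulVf ?pnatr_eq0 -?lt0n // powRr1.
Qed.

Lemma root_mean (R : realType) (k N : nat) (b y : R) : (0 < k)%N -> 0 <= b -> b <= y ->
  exists w : R, [/\ b <= w, w <= y & w ^+ k = (y ^+ k + N%:R * b ^+ k) / N.+1%:R].
Proof.
move=> k0 b0 by_; have y0 := le_trans b0 by_.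
have hk : b ^+ k <= y ^+ k by exact: lerXn2r.
have N0 : (0 : R) < N.+1%:R by rewrite ltr0n.
have bk := exprn_ge0 k b0.
set z := (_ / _); have z0 : 0 <= z by rewrite divr_ge0 // addr_ge0 ?mulr_ge0 ?exprn_ge0.
pose w := z `^ (k%:R^-1).
have wk : w ^+ k = z by exact: powR_invK.
have w0 : 0 <= w by exact: powR_ge0.
exists w; split=> //; rewrite -(@ler_pXn2r _ k) // ?nnegrE // wk.
- by rewrite ler_pdivlMr // -[N.+1]addn1 natrD mulrDr mulr1 addrC mulrC lerD2r.
- rewrite ler_pdivrMr // -[N.+1]addn1 natrD mulrDr mulr1 addrC lerD2r mulrC.
  by rewrite ler_wpM2r.
Qed.

(** * Compression of set families *)

Definition swap_set (T : finType) (i j : T) (A : {set T}) : {set T} :=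
  (tperm i j @: A)%SET.

Lemma mem_swap_set (T : finType) (i j x : T) (A : {set T}) :
  (x \in swap_set i j A) = (tperm i j x \in A).
Proof. by rewrite -{1}[x](tpermK i j) mem_imset //; exact: perm_inj. Qed.

Lemma swap_setK (T : finType) (i j : T) : involutive (swap_set i j).
Proof. by move=> A; apply/setP => x; rewrite !mem_swap_set tpermK. Qed.

Lemma card_swap_set (T : finType) (i j : T) (A : {set T}) : #|swap_set i j A| = #|A|.
Proof. by rewrite card_imset //; exact: perm_inj. Qed.

Lemma swap_setI (T : finType) (i j : T) (A B : {set T}) :
  swap_set i j (A :&: B) = swap_set i j A :&: swap_set i j B.
Proof. by apply/setP => x; rewrite !inE !mem_swap_set inE. Qed.

Lemma card_swap_setI (T : finType) (i j : T) (A B : {set T}) :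
  #|swap_set i j A :&: swap_set i j B| = #|A :&: B|.
Proof. by rewrite -swap_setI card_swap_set. Qed.

Lemma swap_set_id (T : finType) (i j : T) (A : {set T}) :
  (i \in A) = (j \in A) -> swap_set i j A = A.
Proof.
by move=> h; apply/setP => x; rewrite mem_swap_set; case: tpermP => // ->.
Qed.

(* The compression of [G] replacing [j] by [i], described by its members. *)
Definition shift_family (T : finType) (i j : T) (G : {set {set T}}) : {set {set T}} :=
  [set A : {set T} | if (j \in A) && (i \notin A)
    then (A \in G) && (swap_set i j A \in G)
    else (A \in G) || (swap_set i j A \in G)]%SET.

(** If [j] is in [B], the swap fixes [B]. Otherwise the only possible new common point is [j],
    coming from [i] in [B]; then [i] is in [A] as well and is a common point lost in exchange. *)
Lemma card_setI_swap (T : finType) (i j : T) (A B : {set T}) :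
  (j \in A -> i \in A) -> (j \in B -> i \in B) ->
  (#|A :&: swap_set i j B| <= #|A :&: B|)%N.
Proof.
move=> hA hB; have [jB|jB] := boolP (j \in B).
  by rewrite swap_set_id // jB hB.
rewrite -(card_swap_set i j) swap_setI swap_setK subset_leq_card //.
apply/fintype.subsetP => x; rewrite !inE mem_swap_set => /andP[].
case: tpermP => [->|->|_ _ -> -> //]; last by rewrite (negPf jB).
by move=> jA ->; rewrite hA.
Qed.

(** A member containing [j] but not [i] survives only together with its swap, so the version
    matching the other set can be chosen. If neither set is of this kind, [card_setI_swap] handles
    the mixed case. *)
Lemma shift_family_intersecting (T : finType) (i j : T) (t : nat) (G : {set {set T}}) :
  {in G &, forall A B : {set T}, (t <= #|A :&: B|)%N} ->
  {in shift_family i j G &, forall A B : {set T}, (t <= #|A :&: B|)%N}.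
Proof.
move=> hG; suff main A B : A \in shift_family i j G -> B \in shift_family i j G ->
    (j \in A -> i \in A) \/ (j \in B) && (i \notin B) -> (t <= #|A :&: B|)%N.
  move=> A B SA SB; have [/andP[jA iA]|dA] := boolP ((j \in A) && (i \notin A)).
    by rewrite finset.setIC main //; right; rewrite jA.
  by apply: main => //; left=> jA; move: dA; rewrite jA negbK.
rewrite !inE => SA SB [hA|dB]; last first.
  move: SB; rewrite dB => /andP[BG sBG].
  have : (A \in G) || (swap_set i j A \in G) by case: ifP SA => // _ /andP[->].
  by case/orP => AG; [exact: hG|rewrite -(card_swap_setI i j); exact: hG].
have dA : (j \in A) && (i \notin A) = false by apply/andP => -[/hA ->].
rewrite dA in SA; move: SB; have [dB|dB] := boolP ((j \in B) && (i \notin B)).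
  move=> /andP[BG sBG]; case/orP: SA => AG; first exact: hG.
  by rewrite -(card_swap_setI i j); exact: hG.
have hB : j \in B -> i \in B by move=> jB; move: dB; rewrite jB negbK.
have hAB := card_setI_swap hA hB.
case/orP: SA => AG /orP[] BG.
- exact: hG.
- by apply: leq_trans hAB; exact: hG.
- apply: leq_trans hAB; rewrite -(card_swap_setI i j) swap_setK; exact: hG.
- by rewrite -(card_swap_setI i j); exact: hG.
Qed.

(** Doubling pairs each set with its swap. Compression changes membership only inside such pairs, so
    sums can be compared pair by pair. *)
Lemma sum_swap_set (T : finType) (R : numDomainType) (i j : T) (w : {set T} -> R)
    (G : {set {set T}}) :
  (\sum_(A in G) w A) *+ 2 =
  \sum_(A : {set T}) (w A *+ (A \in G) + w (swap_set i j A) *+ (swap_set i j A \in G)).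
Proof.
have E : \sum_(A in G) w A = \sum_(A : {set T}) w A *+ (A \in G).
  by rewrite big_mkcond; apply: eq_bigr => A _; case: (A \in G).
by rewrite big_split /= mulr2n {2}E E [in X in _ + X](reindex_inj (can_inj (swap_setK i j))).
Qed.

Lemma shift_sum_pair (T : finType) (R : numDomainType) (i j : T) (w : {set T} -> R)
    (G : {set {set T}}) (A : {set T}) :
  (forall A : {set T}, j \in A -> i \notin A -> w A <= w (swap_set i j A)) ->
  w A *+ (A \in G) + w (swap_set i j A) *+ (swap_set i j A \in G) <=
  w A *+ (A \in shift_family i j G) +
  w (swap_set i j A) *+ (swap_set i j A \in shift_family i j G).
Proof.
move=> hw; rewrite /shift_family !inE swap_setK !mem_swap_set tpermL tpermR.
have [jA|jA] := boolP (j \in A); have [iA|iA] := boolP (i \in A) => /=.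
- by rewrite swap_set_id ?orbb ?iA ?jA.
- have := hw A jA iA; case: (A \in G); case: (swap_set i j A \in G) => //=;
  by rewrite ?addr0 ?add0r.
- have := hw (swap_set i j A); rewrite swap_setK !mem_swap_set tpermL tpermR => /(_ iA jA).
  by case: (A \in G); case: (swap_set i j A \in G) => //=; rewrite ?addr0 ?add0r.
- by rewrite swap_set_id ?orbb // (negPf iA) (negPf jA).
Qed.

Lemma shift_sum_le (T : finType) (R : numDomainType) (i j : T) (w : {set T} -> R)
    (G : {set {set T}}) :
  (forall A : {set T}, j \in A -> i \notin A -> w A <= w (swap_set i j A)) ->
  \sum_(A in G) w A <= \sum_(A in shift_family i j G) w A.
Proof.
move=> hw; rewrite -(@ler_pMn2r _ 2) // !(sum_swap_set i j).
by apply: ler_sum => A _; exact: shift_sum_pair.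
Qed.

Lemma shift_sum_lt (T : finType) (R : numDomainType) (i j : T) (w : {set T} -> R)
    (G : {set {set T}}) (A : {set T}) :
  (forall A : {set T}, j \in A -> i \notin A -> w A <= w (swap_set i j A)) ->
  A \in G -> j \in A -> i \notin A -> swap_set i j A \notin G ->
  w A < w (swap_set i j A) ->
  \sum_(A in G) w A < \sum_(A in shift_family i j G) w A.
Proof.
move=> hw AG jA iA sA lt_w; rewrite -(@ltr_pMn2r _ 2) // !(sum_swap_set i j).
rewrite (bigD1 A) //= [ltRHS](bigD1 A) //= ltr_leD //; last first.
  by apply: ler_sum => B _; exact: shift_sum_pair.
rewrite /shift_family !inE swap_setK !mem_swap_set tpermL tpermR jA iA (negPf sA) AG /=.
by rewrite (negPf iA) /= addr0 add0r.
Qed.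

(** * Initial segments and values of families of traces *)

Definition initial (n m : nat) : {set 'I_n} := [set i : 'I_n | (i < m)%N]%SET.

Lemma mem_initial (n m : nat) (i : 'I_n) : (i \in initial n m) = (i < m)%N.
Proof. by rewrite inE. Qed.

Lemma card_initial (n m : nat) : (m <= n)%N -> #|initial n m| = m.
Proof.
move=> mn; have -> : initial n m = [set widen_ord mn i | i : 'I_m]%SET.
  apply/setP => i; rewrite mem_initial; apply/idP/imsetP => [im|[j _ ->]].
    by exists (Ordinal im) => //; apply: val_inj.
  exact: (ltn_ord j).
rewrite card_imset ?card_ord // => i j /(congr1 val) /= h; exact: val_inj.
Qed.

Lemma initialS (n m : nat) (mn : (m < n)%N) :
  initial n m.+1 = Ordinal mn |: initial n m.
Proof.
apply/setP => i; rewrite !inE ltnS leq_eqVlt; congr (_ || _).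
Qed.

Lemma initialD1 (n m : nat) (mn : (m < n)%N) :
  initial n m.+1 :\ Ordinal mn = initial n m.
Proof. by rewrite initialS setU1K // mem_initial /= ltnn. Qed.

Lemma subset_initialP (n m : nat) (D : {set 'I_n}) :
  reflect {in D, forall i : 'I_n, (i < m)%N} (D \subset initial n m).
Proof.
apply: (iffP fintype.subsetP) => h i /h; first by rewrite mem_initial.
by rewrite mem_initial.
Qed.

Lemma sum_family_split (T : finType) (R : nmodType) (p : T) (G : {set {set T}})
    (f : {set T} -> R) :
  \sum_(E in G) f E = \sum_(E in G | p \notin E) f E +
    \sum_(D : {set T} | (p \notin D) && (p |: D \in G)) f (p |: D).
Proof.
rewrite (bigID (fun E : {set T} => p \notin E)) /=; congr (_ + _).
rewrite (reindex_onto (fun D => p |: D) (fun E : {set T} => E :\ p)) /=.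
  apply: eq_bigl => D; rewrite setU11 /= andbT.
  have [pD|pD] := boolP (p \in D); last by rewrite setU1K ?eqxx ?andbT.
  apply/negP => /andP[_ /eqP h]; move: pD; rewrite -h.
  by rewrite !inE eqxx.
by move=> E /andP[_]; rewrite negbK => pE; rewrite finset.setD1K.
Qed.

(* The sum over the k-sets whose trace on [m] lies in [G], divided by [k] in [family_poly];
   [b] is the weight of every point outside [m]. *)
Definition level_val (R : realFieldType) (n k m : nat) (x : 'I_n -> R) (b : R)
    (G : {set {set 'I_n}}) : R :=
  \sum_(E in G) (\prod_(i in E) x i) * tailw k (n - m) b #|E|.

Definition admissible (R : realFieldType) (n k m : nat) (x : 'I_n -> R) (b : R) : Prop :=
  [/\ 0 <= b, forall i : 'I_n, (i < m)%N -> b <= x i,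
      forall i j : 'I_n, (i <= j)%N -> (j < m)%N -> x j <= x i &
      \sum_(i in initial n m) x i ^+ k + (n - m)%:R * b ^+ k = 1].

Lemma admissible_ge0 (R : realFieldType) (n k m : nat) (x : 'I_n -> R) (b : R) :
  admissible k m x b -> forall i : 'I_n, (i < m)%N -> 0 <= x i.
Proof. by case=> b0 bx _ _ i /bx; exact: le_trans. Qed.

(** The [k]-th power mean is the common weight that preserves the normalisation; lying between [b]
    and the merged weight, it also preserves the order. *)
Lemma admissible_merge (R : realType) (n k m : nat) (mn : (m < n)%N) (x : 'I_n -> R) (b : R) :
  (0 < k)%N -> admissible k m.+1 x b ->
  exists w : R, [/\ b <= w, w <= x (Ordinal mn),
    w ^+ k = (x (Ordinal mn) ^+ k + (n - m.+1)%:R * b ^+ k) / (n - m.+1).+1%:R &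
    admissible k m x w].
Proof.
move=> k0 [b0 bx xs x1]; set p := Ordinal mn.
have bp : b <= x p by apply: bx; rewrite /= ltnSn.
have [w [bw wp wE]] := root_mean (n - m.+1) k0 b0 bp.
exists w; split=> //; split.
- exact: le_trans bw.
- by move=> i im; apply: le_trans wp _; apply: xs; rewrite /= ?ltnSn // ltnW.
- by move=> i j ij jm; apply: xs => //; exact: ltnW.
- rewrite -[RHS]x1 initialS big_setU1 ?mem_initial ?ltnn //= -/p.
  have -> : (n - m)%N = (n - m.+1).+1 by lia.
  have -> : (n - m.+1).+1%:R * w ^+ k = x p ^+ k + (n - m.+1)%:R * b ^+ k.
    by rewrite wE mulrC divfK ?pnatr_eq0.
  by rewrite addrCA addrA.
Qed.

(** * The star at every level and its optimal weights *)

Definition star_trace (n m t : nat) : {set {set 'I_n}} :=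
  [set E : {set 'I_n} | (initial n t \subset E) && (E \subset initial n m)]%SET.

(** The new point lies off the centre, so star traces on [m.+1] are those on [m] with or without it:
    for the star the step is an identity. *)
Lemma level_val_star_step (R : realFieldType) (n k t m : nat) (mn : (m < n)%N)
    (x : 'I_n -> R) (b : R) : (t <= m)%N ->
  level_val k m.+1 x b (star_trace n m.+1 t) =
  \sum_(D in star_trace n m t) (\prod_(i in D) x i) *
    (tailw k (n - m.+1) b #|D| + x (Ordinal mn) * tailw k (n - m.+1) b #|D|.+1).
Proof.
move=> tm; set p := Ordinal mn; rewrite /level_val (sum_family_split p) /=.
have pt : p \notin initial n t by rewrite mem_initial -leqNgt.
have pm : p \notin initial n m by rewrite mem_initial -leqNgt.
under [RHS]eq_bigr do rewrite mulrDr; rewrite big_split /=; congr (_ + _).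
  apply: eq_bigl => D; rewrite !inE -andbA; congr (_ && _).
  rewrite initialS -/p; apply/andP/idP => [[/fintype.subsetP Dm pD]|Dm].
    apply/fintype.subsetP => i iD; have := Dm _ iD; rewrite in_setU1.
    by case/orP => // /eqP ip; rewrite ip (negPf pD) in iD.
  split; first by apply: fintype.subset_trans Dm _; exact: finset.subsetUr.
  by apply: contra pm; exact: (fintype.subsetP Dm).
apply: eq_big => [D|D /andP[pD _]]; last first.
  by rewrite big_setU1 //= cardsU1 pD add1n -mulrA mulrCA.
rewrite !inE initialS -/p; apply/and3P/andP => [[pD tD Dm]|[tD Dm]].
  split.
    apply/fintype.subsetP => i it; have := fintype.subsetP tD _ it.
    by rewrite in_setU1 => /orP[/eqP ip|//]; rewrite -ip it in pt.
  apply/fintype.subsetP => i iD.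
  have := fintype.subsetP Dm i; rewrite !in_setU1 iD orbT => /(_ isT) /orP[/eqP ip|//].
  by rewrite -ip iD in pD.
split; last by exact: finset.setUS.
  by apply: contra pm; exact: (fintype.subsetP Dm).
by apply: fintype.subset_trans tD _; exact: finset.subsetUr.
Qed.

(* The maximizer of the star's polynomial: the weight on the centre and off it. *)
Definition star_head (R : realType) (k : nat) : R := (k%:R^-1) `^ (k%:R^-1).
Definition star_tail (R : realType) (n k t : nat) : R :=
  ((k - t)%:R / (k%:R * (n - t)%:R)) `^ (k%:R^-1).
Definition star_val (R : realType) (n k t : nat) : R :=
  star_head R k ^+ t * star_tail R n k t ^+ (k - t) * 'C(n - t, k - t)%:R.

Lemma star_headX (R : realType) (k : nat) : (0 < k)%N -> star_head R k ^+ k = k%:R^-1.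
Proof. by move=> k0; rewrite powR_invK // invr_ge0. Qed.

Lemma star_tailX (R : realType) (n k t : nat) : (0 < k)%N ->
  star_tail R n k t ^+ k = (k - t)%:R / (k%:R * (n - t)%:R).
Proof. by move=> k0; rewrite powR_invK // divr_ge0 ?mulr_ge0. Qed.

Lemma star_head_gt0 (R : realType) (k : nat) : (0 < k)%N -> 0 < star_head R k.
Proof. by move=> k0; rewrite powR_gt0 // invr_gt0 ltr0n. Qed.

Lemma star_tail_gt0 (R : realType) (n k t : nat) :
  (t < k)%N -> (k < n)%N -> 0 < star_tail R n k t.
Proof.
move=> tk kn; rewrite powR_gt0 // divr_gt0 ?mulr_gt0 ?ltr0n ?subn_gt0 //.
  exact: leq_ltn_trans tk.
exact: ltn_trans kn.
Qed.

Lemma star_tail_lt_head (R : realType) (n k t : nat) :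
  (t < k)%N -> (k < n)%N -> star_tail R n k t < star_head R k.
Proof.
move=> tk kn; have k0 : (0 < k)%N by exact: leq_ltn_trans tk.
rewrite -(@ltr_pXn2r _ k) // ?nnegrE ?powR_ge0 // star_headX // star_tailX //.
have kR : (0 : R) < k%:R by rewrite ltr0n.
have nt : (0 : R) < (n - t)%:R by rewrite ltr0n subn_gt0 (ltn_trans tk).
by rewrite ltr_pdivrMr ?mulr_gt0 // mulKf ?gt_eqF // ltr_nat ltn_sub2r // (ltn_trans tk).
Qed.

(** AM-GM for the [t] numbers [x i ^+ k] and [k - t] copies of [c * b ^+ k], where
    [c = (n - t) / (k - t)] makes their sum the normalisation 1. Equality means that all of them are
    [1 / k]. *)
Lemma star_base (R : realType) (n k t : nat) (x : 'I_n -> R) (b : R) :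
  (t < k)%N -> (k < n)%N -> admissible k t x b ->
  (\prod_(i in initial n t) x i) * b ^+ (k - t) <=
    star_head R k ^+ t * star_tail R n k t ^+ (k - t) ?=
  iff [forall i in initial n t, x i == star_head R k] && (b == star_tail R n k t).
Proof.
move=> tk kn adm; have x0 := admissible_ge0 adm; have [b0 _ _ x1] := adm.
have k0 : (0 < k)%N by exact: leq_ltn_trans tk.
have kR : (0 : R) < k%:R by rewrite ltr0n.
have ntR : (0 : R) < (n - t)%:R by rewrite ltr0n subn_gt0 (ltn_trans tk).
have ktR : (0 : R) < (k - t)%:R by rewrite ltr0n subn_gt0.
pose c : R := (n - t)%:R / (k - t)%:R; have c0 : 0 < c by rewrite divr_gt0.
have ha := star_headX R k0; have hb := star_tailX R n t k0.
set al := star_head R k in ha *; set be := star_tail R n k t in hb *.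
have al0 : 0 < al by exact: star_head_gt0.
have be0 : 0 < be by exact: star_tail_gt0.
have hcb : c * be ^+ k = k%:R^-1.
  by rewrite hb /c; field; rewrite !gt_eqF.
(* [A] provides [k] indices: [t] for the centre and [k - t] for equal shares of the tail. *)
pose A := initial n k.
pose E (y : 'I_n -> R) (d : R) (i : 'I_n) := if (i < t)%N then y i ^+ k else c * d ^+ k.
have cA : #|A| = k by rewrite card_initial // ltnW.
have cD : #|A :\: initial n t| = (k - t)%N.
  rewrite cardsD (finset.setIidPr _) ?cA ?card_initial //; first by rewrite ltnW // (ltn_trans tk).
  by apply/subset_initialP => i; rewrite mem_initial => /ltn_trans; exact.
have prodE y d : \prod_(i in A) E y d i =
    ((\prod_(i in initial n t) y i) * d ^+ (k - t)) ^+ k * c ^+ (k - t).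
  rewrite (bigID (fun i => i \in initial n t)) /=.
  rewrite (eq_big (fun i => i \in initial n t) (fun i => y i ^+ k)); first last.
  - by move=> i /andP[_]; rewrite mem_initial => it; rewrite /E it.
  - move=> i; rewrite !mem_initial andbC; case: ltnP => //= it; exact: ltn_trans tk.
  rewrite prodrXl [X in _ * X](eq_big (fun i => i \in A :\: initial n t)
    (fun=> c * d ^+ k)); first last.
  - by move=> i /andP[_]; rewrite mem_initial => /negPf it; rewrite /E it.
  - by move=> i; rewrite finset.in_setD andbC.
  by rewrite prodr_const cD !exprMn -!exprM [(k * _)%N]mulnC; ring.
have sumE : \sum_(i in A) E x b i = 1.
  rewrite -[RHS]x1 (bigID (fun i => i \in initial n t)) /=; congr (_ + _).
    apply: eq_big => i; last by move=> /andP[_]; rewrite mem_initial => it; rewrite /E it.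
    rewrite !mem_initial andbC; case: ltnP => //= it; exact: ltn_trans tk.
  rewrite (eq_big (fun i => i \in A :\: initial n t) (fun=> c * b ^+ k)); first last.
  - by move=> i /andP[_]; rewrite mem_initial => /negPf it; rewrite /E it.
  - by move=> i; rewrite finset.in_setD andbC.
  by rewrite sumr_const cD -[LHS]mulr_natl /c; field; rewrite gt_eqF.
have E0 : {in A, forall i, 0 <= E x b i}.
  move=> i _; rewrite /E; case: ifP => it; first by rewrite exprn_ge0 ?x0.
  by rewrite mulr_ge0 ?exprn_ge0 // ltW.
have := leif_AGM E0; rewrite sumE cA prodE.
(* The maximal product is found by feeding the maximizer itself into [prodE]. *)
have opt : (1 / k%:R) ^+ k = (al ^+ t * be ^+ (k - t)) ^+ k * c ^+ (k - t).
  have := prodE (fun=> al) be; rewrite prodr_const card_initial => [<-|]; last first.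
    by rewrite ltnW // (ltn_trans tk).
  rewrite (eq_bigr (fun=> 1 / k%:R)) ?prodr_const ?cA // => i _.
  by rewrite /E ha hcb div1r; case: ifP.
rewrite opt => -[h1 h2]; split.
  have := h1; rewrite ler_pM2r ?exprn_gt0 // ler_pXn2r // nnegrE mulr_ge0 ?exprn_ge0 //;
    last by rewrite ltW.
  - by apply: prodr_ge0 => i; rewrite mem_initial => /x0.
  - by rewrite ltW.
transitivity [forall i in A, forall j in A, E x b i == E x b j].
  have cn0 : c ^+ (k - t) != 0 by rewrite expf_neq0 // gt_eqF.
  rewrite -h2 (inj_eq (mulIf cn0)) eqrXn2 //; last by rewrite mulr_ge0 ?exprn_ge0 // ltW.
  rewrite mulr_ge0 ?exprn_ge0 //.
  by apply: prodr_ge0 => i; rewrite mem_initial => /x0.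
have tn : (t < n)%N by exact: ltn_trans kn.
pose it := Ordinal tn; have itA : it \in A by rewrite mem_initial.
apply/forall_inP/andP => [h|[/forall_inP hx /eqP hb'] i iA].
  have Ec i : i \in A -> E x b i = k%:R^-1.
    move=> iA; have : \sum_(j in A) E x b j = \sum_(j in A) E x b i.
      by apply: eq_bigr => j jA; apply/eqP; exact: (forall_inP (h j jA)).
    rewrite sumE sumr_const cA => h'.
    by apply: (mulfI (x := k%:R)); rewrite ?gt_eqF // mulr_natl -h' divff // gt_eqF.
  split.
    apply/forall_inP => i; rewrite mem_initial => iit.
    rewrite -(@eqrXn2 _ k) ?x0 // ?(ltW al0) // ha -(Ec i) /E ?iit //.
    by rewrite mem_initial (ltn_trans iit).
  have cn0 : c != 0 by rewrite gt_eqF.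
  rewrite -(@eqrXn2 _ k) ?(ltW be0) // -(inj_eq (mulfI cn0)) hcb.
  by rewrite -(Ec it) // /E /= ltnn.
apply/forall_inP => j jA; suff h l : l \in A -> E x b l = k%:R^-1 by rewrite !h.
rewrite /E hb' hcb => _; case: ifP => // lt; rewrite -ha.
by have := hx l; rewrite mem_initial lt => /(_ isT) /eqP ->.
Qed.

(** At [m = n] no point carries [b], so the off-centre value is a separate [b0], tied to [b] only
    when [m < n]. *)
Definition two_valued (R : realFieldType) (n t m : nat) (x : 'I_n -> R) (b : R) : Prop :=
  exists b0 : R, [/\ 0 < b0, forall i : 'I_n, (i < t)%N -> b0 < x i,
    forall i : 'I_n, (t <= i)%N -> (i < m)%N -> x i = b0 & (m < n)%N -> b = b0].

Lemma two_valued_gt0 (R : realFieldType) (n t m : nat) (x : 'I_n -> R) (b : R) :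
  two_valued t m x b -> forall i : 'I_n, (i < m)%N -> 0 < x i.
Proof.
case=> b0 [b00 bx xb _] i im; case: (ltnP i t) => it; last by rewrite xb.
exact: lt_trans (bx i it).
Qed.

Lemma prod_trace_ge0 (R : realFieldType) (n m : nat) (x : 'I_n -> R) (D : {set 'I_n}) :
  (forall i : 'I_n, (i < m)%N -> 0 <= x i) -> D \subset initial n m ->
  0 <= \prod_(i in D) x i.
Proof. by move=> x0 /subset_initialP Dm; apply: prodr_ge0 => i /Dm /x0. Qed.

Lemma prod_trace_gt0 (R : realFieldType) (n m : nat) (x : 'I_n -> R) (D : {set 'I_n}) :
  (forall i : 'I_n, (i < m)%N -> 0 < x i) -> D \subset initial n m ->
  0 < \prod_(i in D) x i.
Proof. by move=> x0 /subset_initialP Dm; apply: prodr_gt0 => i /Dm /x0. Qed.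

Lemma level_val_star_base (R : realFieldType) (n k t : nat) (x : 'I_n -> R) (b : R) :
  (t <= n)%N -> (t <= k)%N -> level_val k t x b (star_trace n t t) =
  (\prod_(i in initial n t) x i) * b ^+ (k - t) * 'C(n - t, k - t)%:R.
Proof.
move=> tn tk; rewrite /level_val (_ : star_trace n t t = [set initial n t]%SET).
  by rewrite big_set1 card_initial // /tailw tk mulrA.
by apply/setP => E; rewrite !inE finset.eqEsubset andbC.
Qed.

(** Each merge can only raise the value, and at [m = t] [star_base] applies. In the equality case
    [b < x p] would give a strict gain, so the two-valued shape lifts back to the higher level. *)
Lemma star_level (R : realType) (n k t m : nat) (x : 'I_n -> R) (b : R) :
  (1 < k)%N -> (t < k)%N -> (k < n)%N -> (t <= m <= n)%N -> admissible k m x b ->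
  level_val k m x b (star_trace n m t) <= star_val R n k t /\
  (level_val k m x b (star_trace n m t) = star_val R n k t -> two_valued t m x b).
Proof.
move=> k1 tk kn /andP[tm mn]; have k0 := ltnW k1.
elim: m tm mn x b => [|m IH] tm mn x b adm.
  move: tm; rewrite leqn0 => /eqP t0; subst t.
  have tn : (0 < n)%N by exact: leq_ltn_trans kn.
  have [h1 h2] := star_base tk kn adm.
  have C0 : (0 : R) < 'C(n - 0, k - 0)%:R by rewrite !subn0 ltr0n bin_gt0 ltnW.
  rewrite level_val_star_base // /star_val; split; first by rewrite ler_pM2r.
  move/(mulIf (lt0r_neq0 C0)) => /eqP; rewrite h2 => /andP[_ /eqP bE].
  by exists b; split=> //; rewrite bE star_tail_gt0.
have [tE|tm'] : t = m.+1 \/ (t <= m)%N.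
- by move: tm; rewrite leq_eqVlt ltnS => /orP[/eqP|]; [left|right].
- subst t; have [h1 h2] := star_base tk kn adm.
  have C0 : (0 : R) < 'C(n - m.+1, k - m.+1)%:R by rewrite ltr0n bin_gt0 leq_sub2r // ltnW.
  rewrite level_val_star_base // ?(ltnW tk) // /star_val; split; first by rewrite ler_pM2r.
  move/(mulIf (lt0r_neq0 C0)) => /eqP; rewrite h2 => /andP[/forall_inP xE /eqP bE].
  exists b; rewrite bE star_tail_gt0 //; split=> // i.
    by move=> im; rewrite (eqP (xE i _)) ?mem_initial // star_tail_lt_head.
  by rewrite leqNgt => /negP.
have [w [bw wp wE admw]] := admissible_merge mn k0 adm.
set p := Ordinal mn in wp wE.
have x0 := admissible_ge0 adm; have [b0 bx _ _] := adm.
have w0 : 0 <= w by exact: le_trans bw.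
have p0 : 0 <= x p by apply: x0; rewrite /= ltnSn.
have [h1 h2] := IH tm' (ltnW mn) _ _ admw.
have nm : (n - m = (n - m.+1).+1)%N by lia.
have termle D : D \in star_trace n m t -> (\prod_(i in D) x i) *
    (tailw k (n - m.+1) b #|D| + x p * tailw k (n - m.+1) b #|D|.+1) <=
    (\prod_(i in D) x i) * tailw k (n - m) w #|D|.
  rewrite inE => /andP[_ Dm]; rewrite ler_wpM2l //; last by rewrite nm; exact: tailw_merge.
  by apply: prod_trace_ge0 Dm => i im; apply: x0; exact: ltnW.
have le1 : level_val k m.+1 x b (star_trace n m.+1 t) <= level_val k m x w (star_trace n m t).
  by rewrite level_val_star_step //; apply: ler_sum.
split=> [|eq1]; first exact: le_trans h1.
have eq2 : level_val k m x w (star_trace n m t) = star_val R n k t.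
  by apply/eqP; rewrite eq_le h1 -eq1.
have tv := h2 eq2; have xm0 := two_valued_gt0 tv.
case: tv => c [c0 cx xc wc].
have wc' : w = c by exact: wc.
suff [xpc bc] : x p = c /\ ((m.+1 < n)%N -> b = c).
  exists c; split=> // i ti; rewrite ltnS leq_eqVlt => /orP[/eqP im|]; last exact: xc.
  by rewrite (_ : i = p) //; apply: val_inj.
have [nE|nE] : n = m.+1 \/ (m.+1 < n)%N.
- by have := mn; rewrite leq_eqVlt => /orP[/eqP|]; [left|right].
- split; last by rewrite -nE ltnn.
  move: wE; rewrite -nE subnn mul0r addr0 divr1 => /eqP.
  by rewrite eqrXn2 // => /eqP <-.
have [bp|] := ltP b (x p); last first.
  move=> pb; have xb : x p = b by apply/eqP; rewrite eq_le pb (le_trans bw).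
  by rewrite -wc' xb in wp *; split=> [|_]; apply/eqP; rewrite eq_le bw wp.
exfalso; suff : level_val k m.+1 x b (star_trace n m.+1 t) < star_val R n k t.
  by rewrite eq1 ltxx.
rewrite level_val_star_step // -eq2 /level_val.
(* A star trace where the gain is strict: [e >= k - (n - m)] makes it completable, and [e < k]
   leaves a point to be completed. *)
pose e := maxn t (k - (n - m)); have em : (e <= m)%N by rewrite /e; lia.
have Dm : initial n e \in star_trace n m t.
  rewrite inE; apply/andP; split; apply/subset_initialP => i; rewrite mem_initial => h.
    by apply: leq_trans h _; rewrite leq_maxl.
  exact: leq_trans h _.
rewrite (bigD1 (initial n e)) //= [ltRHS](bigD1 (initial n e)) //= ltr_leD //; last first.
  by apply: ler_sum => D /andP[DS _]; exact: termle.
rewrite ltr_pM2l; last by apply: prod_trace_gt0 (xm0) _; move: Dm; rewrite inE => /andP[].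
have nm1 : (n - m.+1 = (n - m.+2).+1)%N by lia.
rewrite nm nm1; apply: tailw_merge_lt => //; first by rewrite -nm1.
rewrite card_initial; last by exact: leq_trans em (ltnW mn).
by rewrite -nm1 -nm /e; lia.
Qed.

(** * Consequences of the lower bound on [n] *)

Definition large_ground (R : realType) (n k t : nat) : Prop :=
  ((t + 1) * (k - t + 1))%N%:R + (t + 1)%N%:R * ln (t + 1)%N%:R <= n%:R :> R.

Lemma large_ground_nat (R : realType) (n k t : nat) :
  (2 <= t)%N -> (t < k)%N -> large_ground R n k t ->
  [/\ (3 * k <= n + 2 * t)%N, (k < n)%N & (2 * k < n + t)%N].
Proof.
move=> t2 tk hn; have : ((t + 1) * (k - t + 1) <= n)%N.
  rewrite -(ler_nat R); apply: le_trans hn; rewrite lerDl mulr_ge0 ?ler0n // ln_ge0 //.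
  by rewrite ler1n addn1.
have -> : k = (t + (k - t))%N by lia.
by move: (k - t)%N => e; rewrite addKn => h; split; nia.
Qed.

(** [star_ratio_bound] with [c = k - d] and [M = n - m]. The last condition says that [d] is at
    least half of [m + t - 1], hence [m <= t + 1 + 2 (d - t)] and
    [(t + 1)(k - d) + m <= (t + 1)(k - t + 1)]. *)
Lemma large_ground_key (R : realType) (n k t d m : nat) :
  (2 <= t)%N -> large_ground R n k t -> (t <= d < k)%N -> (t <= m < n)%N ->
  (m + t <= (2 * d).+1)%N ->
  ((k - d)%:R / (n - m)%:R) ^+ k.-1 < (t + 1)%:R^-1 ^+ k :> R.
Proof.
move=> t2 hn /andP[td dk] /andP[tm mn] md; have tk : (t < k)%N by exact: leq_ltn_trans dk.
have nm0 : (0 : R) < (n - m)%:R by rewrite ltr0n subn_gt0.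
have t0 : (0 : R) < (t + 1)%:R by rewrite ltr0n addn1.
rewrite exprMn exprVn exprVn ltr_pdivrMr ?exprn_gt0 // mulrC ltr_pdivlMr ?exprn_gt0 //.
rewrite mulrC; apply: star_ratio_bound => //; [lia|lia|].
have hnat : ((t + 1) * (k - d) + m <= (t + 1) * (k - t + 1))%N.
  have [e dE] : {e | d = (t + e)%N} by exists (d - t)%N; rewrite subnKC.
  have [c kE] : {c | k = (d + c)%N} by exists (k - d)%N; rewrite subnKC // ltnW.
  have -> : (k - d = c)%N by lia.
  have -> : (k - t = e + c)%N by lia.
  by nia.
rewrite (natrB _ (ltnW mn)) lerBrDr; apply: le_trans hn.
by rewrite -addrA [_ * ln _ + _]addrC addrA lerD2r -natrM -natrD ler_nat.
Qed.

(** [tailw_drop] is applied with the exact root [r1 < r]; the slack gives strictness once the new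
    value is positive. For sizes with too few outside points both sides are 0. *)
Lemma tailw_drop_lt (R : realType) (k N d : nat) (b y w r : R) :
  0 <= b -> 0 <= y -> 0 <= w -> 0 < r ->
  w ^+ k = (y ^+ k + N%:R * b ^+ k) / N.+1%:R ->
  (d < k)%N -> ((k - d)%:R / N.+1%:R) ^+ k.-1 < r ^+ k ->
  y * tailw k N b d.+1 <= r * tailw k N.+1 w d /\
  (0 < tailw k N.+1 w d -> y * tailw k N b d.+1 < r * tailw k N.+1 w d).
Proof.
move=> b0 y0 w0 r0 wE dk hr; have k0 : (0 < k)%N by exact: leq_ltn_trans dk.
have [kd|kd] := leqP k (d + N.+1); last first.
  by rewrite !tailw_eq0 ?mulr0 ?ltxx //; lia.
set q : R := (_ / _) ^+ k.-1 in hr; have q0 : 0 <= q by rewrite exprn_ge0 // divr_ge0.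
have r1E := powR_invK k0 q0; set r1 := q `^ _ in r1E.
have r10 : 0 <= r1 by exact: powR_ge0.
have r1r : r1 < r by rewrite -(@ltr_pXn2r _ k) // ?nnegrE ?(ltW r0) // r1E.
have h : y * tailw k N b d.+1 <= r1 * tailw k N.+1 w d.
  by apply: tailw_drop; rewrite ?dk ?kd // r1E.
split; first by apply: le_trans h _; rewrite ler_wpM2r ?tailw_ge0 // ltW.
by move=> T0; apply: le_lt_trans h _; rewrite ltr_pM2r.
Qed.

(** The constant satisfies [(16/25)^3 > 1/4], which starts the induction, and [16/25 + 1/3 < 1],
    which is used when two size classes compete. *)
Lemma half_power_lt (R : realFieldType) (z : R) (k : nat) : (3 <= k)%N ->
  0 <= z -> z <= 1 / 2 -> z ^+ k.-1 < (16 / 25) ^+ k.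
Proof.
move=> k3 z0 z2; apply: (@le_lt_trans _ _ ((1 / 2) ^+ k.-1)).
  by apply: lerXn2r => //; rewrite nnegrE; lra.
case: k k3 => [|[|[|k]]] //= _.
elim: k => [|k IH]; first by lra.
rewrite exprS [ltRHS]exprS; apply: ltr_pM => //; first by lra.
Qed.

(** * Choosing which traces to keep *)

(** Summed over all [T] in [m], each [D] is counted [m - d] times, so some [T] does at least as well
    as the average. *)
Lemma averaging (R : realDomainType) (n m d : nat) (A : {set {set 'I_n}})
    (f : {set 'I_n} -> R) :
  (0 < m <= n)%N -> {in A, forall D : {set 'I_n}, D \subset initial n m /\ #|D| = d} ->
  exists T : 'I_n, [/\ (T < m)%N &
    (m - d)%:R * \sum_(D in A) f D <= m%:R * \sum_(D in A | T \notin D) f D].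
Proof.
move=> /andP[m0 mn] hA; apply/not_existsP => hT.
have : \sum_(T in initial n m) (m%:R * \sum_(D in A | T \notin D) f D) <
       \sum_(T in initial n m) ((m - d)%:R * \sum_(D in A) f D).
  apply: ltr_sum => [|T].
    by apply/hasP; exists (Ordinal (leq_trans m0 mn)); rewrite ?mem_index_enum ?mem_initial.
  rewrite mem_initial => Tm; rewrite ltNge; apply/negP => h; exact: hT T (conj Tm h).
rewrite -mulr_sumr (exchange_big_dep (mem A)) /=; last by move=> T D _ /andP[].
rewrite sumr_const card_initial //.
have -> : \sum_(D in A) \sum_(T in initial n m | (D \in A) && (T \notin D)) f D =
    (m - d)%:R * \sum_(D in A) f D.
  rewrite mulr_sumr; apply: eq_bigr => D DA; have [Dm Dd] := hA D DA.
  rewrite DA sumr_const mulr_natl; congr (_ *+ _).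
  rewrite -Dd -[in RHS](card_initial mn) -cardsDS //; apply: eq_card => T.
  by rewrite finset.in_setD andbC.
by rewrite mulr_natl ltxx.
Qed.

Lemma sum_by_card (T : finType) (R : pzSemiRingType) (A : {set {set T}}) (s : nat)
    (v : {set T} -> R) (o : nat -> R) :
  {in A, forall D : {set T}, (#|D| <= s)%N} ->
  \sum_(D in A) v D * o #|D| =
  \sum_(d < s.+1) (\sum_(D in A | #|D| == d) v D) * o d.
Proof.
move=> hA; rewrite (partition_big (fun D : {set T} => inord #|D| : 'I_s.+1) predT) //=.
apply: eq_bigr => d _; rewrite mulr_suml; apply: eq_big => [D|D /andP[DA /eqP <-]].
  by case: (boolP (D \in A)) => //= /hA Ds; rewrite -val_eqE /= inordK.
by rewrite inordK ?ltnS ?hA.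
Qed.

(* Abstract form of the choice of size classes: [v D * o #|D|] is the old and [v D * u #|D|] the
   new value of the trace [D].  The classes [d] and [s - d] are the conflicting ones. *)
Section Selection.
Variables (R : realFieldType) (n m t k : nat) (A : {set {set 'I_n}}).
Variables (v : {set 'I_n} -> R) (o u : nat -> R).
Hypotheses (t2 : (2 <= t)%N) (tm : (t <= m)%N) (mn : (m <= n)%N).
Hypothesis hA : {in A, forall D : {set 'I_n}, [/\ D \subset initial n m, (t <= #|D|)%N,
  (#|D| < k)%N & 0 <= v D]}.
Hypothesis hou : forall d, 0 <= o d <= u d.
Hypothesis hbig : forall d, (t <= d < k)%N -> (m + t <= (2 * d).+1)%N ->
  o d <= (t + 1)%:R^-1 * u d /\ (0 < u d -> o d < (t + 1)%:R^-1 * u d).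
Hypothesis hsmall : forall d d', (t <= d)%N -> (d < d' < k)%N -> (d + d').+1 = (m + t)%N ->
  o d <= 16 / 25 * u d.

Let s := (m + t).-1.
Let W (B : {set {set 'I_n}}) (d : nat) : R := \sum_(D in B | #|D| == d) v D.
Let U (d : nat) : R := W A d * u d.
(** Ties go to the larger size, so that exactly one of two distinct complementary sizes is kept. *)
Let keep (d : nat) : bool := (U (s - d)%N < U d) || ((U (s - d)%N == U d) && (s - d < d)%N).

Let u0 (d : nat) : 0 <= u d.
Proof. by have /andP[] := hou d; exact: le_trans. Qed.

Let W0 (B : {set {set 'I_n}}) d : {subset B <= A} -> 0 <= W B d.
Proof. by move=> BA; apply: sumr_ge0 => D /andP[/BA /hA[]]. Qed.

Let WA0 (d : nat) : 0 <= W A d.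
Proof. exact: W0. Qed.

Let U0 (d : nat) : 0 <= U d.
Proof. by rewrite mulr_ge0. Qed.

Let class_range (d : nat) : (t <= d < k)%N \/ W A d = 0.
Proof.
have [/existsP[D /andP[DA /eqP <-]]|h] := boolP [exists D in A, #|D| == d].
  by left; have [_ -> ->] := hA DA.
right; apply: big1 => D /andP[DA Dd]; case/negP: h; apply/existsP; exists D.
by rewrite DA.
Qed.

Let keepC (d : nat) : (d <= s)%N -> (d + d != s)%N -> keep (s - d)%N = ~~ keep d.
Proof.
move=> ds dd; rewrite /keep subKn // negb_or negb_and -!leNgt -leqNgt.
by case: (ltgtP (U d) (U (s - d)%N)) => //= _; rewrite ltn_neqAle andbC; lia.
Qed.

Let keep_bound (d : nat) : (d <= s)%N -> (d + d != s)%N ->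
  let S := (if keep d then U d else 0) + (if keep (s - d)%N then U (s - d)%N else 0) in
  U d <= S /\ U (s - d)%N <= S.
Proof.
move=> ds dd; rewrite keepC //; case: ifP => /= [|/negbT]; rewrite ?add0r ?addr0 /keep.
  by case/orP => [/ltW|/andP[/eqP ->]].
by rewrite negb_or -leNgt => /andP[].
Qed.

(** [S] is the larger of the two new values. In the range [t <= d < k] the old values are at most
    16/25 and 1/3 of the new ones, and these factors add up to less than 1; if one class has total
    0, [o <= u] on the other suffices. *)
Let pair_lt (d : nat) : (d < s - d)%N ->
  let S := (if keep d then U d else 0) + (if keep (s - d)%N then U (s - d)%N else 0) in
  W A d * o d + W A (s - d)%N * o (s - d)%N <= S /\
  (0 < W A d -> 0 < W A (s - d)%N -> 0 < S -> W A d * o d + W A (s - d)%N * o (s - d)%N < S).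
Proof.
move=> lt_d S; have ds : (d <= s)%N by lia.
have [b1 b2] : U d <= S /\ U (s - d)%N <= S by apply: keep_bound => //; lia.
have fU e : W A e * o e <= U e by rewrite ler_wpM2l //; case/andP: (hou e).
have [/andP[td dk]|Wd] := class_range d; last first.
  by rewrite Wd mul0r add0r ltxx; split=> //; apply: le_trans (fU _) b2.
have [/andP[td' dk']|Wd] := class_range (s - d)%N; last first.
  by rewrite Wd mul0r addr0 ltxx; split=> //; apply: le_trans (fU _) b1.
have dd : (d + (s - d)).+1 = (m + t)%N by rewrite /s; lia.
have h1 : W A d * o d <= 16 / 25 * U d.
  by rewrite /U mulrCA ler_wpM2l //; apply: (hsmall td _ dd); rewrite lt_d.
have h2 : W A (s - d)%N * o (s - d)%N <= 1 / 3 * U (s - d)%N.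
  rewrite /U mulrCA ler_wpM2l //.
  have [h _] := hbig (d := (s - d)%N) (introT andP (conj td' dk')) ltac:(lia).
  apply: le_trans h _; rewrite ler_wpM2r // div1r lef_pV2 ?posrE ?ltr0n ?addn1 //.
  by rewrite ler_nat.
have S0 : 0 <= S by exact: le_trans b1.
by split; [lra|move=> _ _ S1; lra].
Qed.

Lemma selection : exists K : {set {set 'I_n}}, [/\ {subset K <= A},
  {in K &, forall D1 D2 : {set 'I_n}, (#|D1| + #|D2|).+1 = (m + t)%N ->
     D1 :|: D2 != initial n m},
  \sum_(D in A) v D * o #|D| <= \sum_(D in K) v D * u #|D| &
  forall D, D \in A -> D \notin K -> 0 < v D -> 0 < u #|D| ->
    \sum_(D in A) v D * o #|D| < \sum_(D in K) v D * u #|D|].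
Proof.
pose d0 := s./2; pose A0 := [set D in A | #|D| == d0]%SET.
have m0 : (0 < m)%N by lia.
have [T [Tm hT]] : exists T : 'I_n, [/\ (T < m)%N &
    (m - d0)%:R * \sum_(D in A0) v D <= m%:R * \sum_(D in A0 | T \notin D) v D].
  by apply: averaging; rewrite ?m0 // => D; rewrite inE => /andP[/hA[] ? _ _ _ /eqP].
(* The middle class conflicts with itself, so it is thinned to the sets avoiding [T]; other classes
   are kept or dropped whole. *)
pose K := [set D in A | if (#|D| + #|D| == s)%N then T \notin D else keep #|D|]%SET.
have KA : {subset K <= A} by move=> D; rewrite inE => /andP[].
have card_s D : D \in A -> (#|D| <= s)%N.
  move=> /hA[/subset_leq_card + _ _ _]; rewrite card_initial // /s; lia.
have WK d : (d + d != s)%N -> W K d * u d = if keep d then U d else 0.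
  move=> dd; rewrite /U /W; case: ifP => kd.
    congr (_ * _); apply: eq_bigl => D; rewrite inE -andbA; congr (_ && _).
    by have [->|] := eqVneq #|D| d; rewrite ?andbT ?andbF // (negPf dd).
  rewrite big1 ?mul0r // => D /andP[+ /eqP Dd].
  by rewrite inE Dd (negPf dd) kd andbF.
have mid d : (d + d = s)%N ->
    W A d * o d <= W K d * u d /\ (0 < W A d -> 0 < u d -> W A d * o d < W K d * u d).
  move=> dd; have dE : d = d0 by rewrite /d0; lia.
  have [td|Wd] := class_range d; last first.
    by rewrite Wd mul0r ltxx mulr_ge0 ?W0.
  have W1 : \sum_(D in A0) v D = W A d.
    by apply: eq_bigl => D; rewrite inE dE.
  have W2 : \sum_(D in A0 | T \notin D) v D = W K d.
    apply: eq_bigl => D; rewrite !inE -!andbA -dE; congr (_ && _).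
    by have [->|] := eqVneq #|D| d; rewrite ?andbT ?andbF // dd eqxx.
  rewrite W1 W2 -dE in hT.
  have t0 : (0 : R) < (t + 1)%:R by rewrite ltr0n addn1.
  (* For [d = t + e] one has [m = t + 2 e + 1] and [m - d = e + 1], so the retained share
     [(m - d) / m] is at least [1 / (t + 1)], the factor in [hbig]. *)
  have hW : (t + 1)%:R^-1 * W A d <= W K d.
    rewrite mulrC ler_pdivrMr // -(ler_pM2r (x := m%:R)) ?ltr0n //.
    rewrite [leRHS]mulrC mulrA; apply: le_trans (ler_wpM2r (ltW t0) hT).
    rewrite mulrAC [leLHS]mulrC ler_wpM2r // -natrM ler_nat.
    case/andP: td => td dk; have [e dE'] : {e | d = (t + e)%N}.
      by exists (d - t)%N; rewrite subnKC.
    have mE : m = (t + 2 * e).+1 by rewrite /s in dd; lia.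
    have -> : (m - d = e.+1)%N by lia.
    rewrite mE; nia.
  have hK : (t + 1)%:R^-1 * (W A d * u d) <= W K d * u d by rewrite mulrA ler_wpM2r.
  have [h1 h2] := hbig td ltac:(rewrite /s in dd; lia).
  split=> [|WA1 u1]; last first.
    by apply: lt_le_trans hK; rewrite mulrCA ltr_pM2l // h2.
  by apply: le_trans hK; rewrite mulrCA ler_wpM2l.
have pair d : (d <= s)%N ->
    W A d * o d + W A (s - d)%N * o (s - d)%N <= W K d * u d + W K (s - d)%N * u (s - d)%N.
  move=> ds; case: (ltngtP d (s - d)) => [lt_d|lt_d|dE].
  - rewrite !WK; [by have [] := pair_lt lt_d|lia|lia].
  - have := @pair_lt (s - d)%N ltac:(lia); rewrite subKn // => -[h _].
    by rewrite [leLHS]addrC [leRHS]addrC !WK; [exact: h|lia|lia].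
  - by rewrite -dE; have [h _] := mid d ltac:(lia); rewrite lerD.
(* Doubling lets the sizes [d] and [s - d] be compared as a pair, the middle size being paired with
   itself. *)
have tot (o' : nat -> R) (B : {set {set 'I_n}}) :
    {subset B <= A} -> (\sum_(D in B) v D * o' #|D|) *+ 2 =
    \sum_(d < s.+1) (W B d * o' d + W B (s - d)%N * o' (s - d)%N).
  move=> BA; rewrite big_split /= mulr2n.
  rewrite (sum_by_card (s := s)); last by move=> D /BA /card_s.
  congr (_ + _); rewrite (reindex_inj rev_ord_inj) /=; apply: eq_bigr => d _.
  by rewrite subSS.
exists K; split=> //.
- move=> D1 D2; rewrite !inE => /andP[_ h1] /andP[_ h2] h12.
  have h12' : (#|D1| + #|D2|)%N = s by rewrite /s -h12.
  (* Equal sizes: both sets avoid [T], which stays uncovered. Unequal sizes: [keepC] excludes one of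
     the two classes. *)
  have [E|E] := eqVneq (#|D1| + #|D1|)%N s.
    have E2 : (#|D2| + #|D2|)%N = s by lia.
    rewrite E eqxx in h1; rewrite E2 eqxx in h2.
    apply/eqP => /setP /(_ T); rewrite finset.in_setU mem_initial Tm (negPf h1) (negPf h2).
    by [].
  rewrite (negPf E) /= in h1; have E2 : (#|D2| + #|D2| != s)%N by lia.
  rewrite (negPf E2) /= in h2; have := @keepC #|D1| ltac:(lia) E.
  have -> : (s - #|D1| = #|D2|)%N by lia.
  by rewrite h1 h2.
- rewrite -(@ler_pMn2r _ 2) // !tot //.
  by apply: ler_sum => d _; apply: pair; rewrite -ltnS.
- move=> D DA DK vD uD; rewrite -(@ltr_pMn2r _ 2) // !tot //.
  have Ds := card_s D DA; pose dD : 'I_s.+1 := Ordinal (Ds : #|D| < s.+1)%N.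
  rewrite (bigD1 dD) //= [ltRHS](bigD1 dD) //= ltr_leD //; last first.
    by apply: ler_sum => d _; apply: pair; rewrite -ltnS.
  have WD : 0 < W A #|D|.
    rewrite /W (bigD1 D) ?DA //=; apply: (lt_le_trans vD); rewrite lerDl.
    by apply: sumr_ge0 => E /andP[/andP[/hA[]]].
  have UD : 0 < U #|D| by rewrite mulr_gt0.
  move: DK; rewrite inE DA /=; have [E _|E nk] := eqVneq (#|D| + #|D|)%N s.
    have [_ h] := mid _ E; have -> : (s - #|D| = #|D|)%N by rewrite -E addnK.
    by rewrite ltrD ?h.
  (* A class is dropped only in favour of one with at least its new value, which is therefore
     positive. *)
  have Wc : 0 < W A (s - #|D|)%N.
    have [_ h] := keep_bound Ds E; have [h' _] := keep_bound Ds E.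
    rewrite (negPf nk) add0r keepC // nk in h'.
    have := lt_le_trans UD h'; rewrite /U; have := WA0 (s - #|D|)%N.
    by rewrite le_eqVlt => /orP[/eqP <-|//]; rewrite mul0r ltxx.
  have [b1 b2] := keep_bound Ds E.
  have E' : (s - #|D| + (s - #|D|) != s)%N.
    by apply: contra E => /eqP; clear - Ds; lia.
  case: (ltngtP #|D| (s - #|D|)%N) => [lt_d|lt_d|dE].
  - rewrite !WK //.
    by have [_] := pair_lt lt_d; apply=> //; exact: lt_le_trans b1.
  - have := @pair_lt (s - #|D|)%N; rewrite subKn // => /(_ lt_d) [_ h].
    rewrite !WK //.
    by rewrite [ltLHS]addrC [ltRHS]addrC; apply: h => //; rewrite addrC; exact: lt_le_trans b1.
  - by case/negP: E; rewrite {2}dE subnKC.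
Qed.

End Selection.

(** * Passing from level [m + 1] to level [m] *)

(* The traces [D] that are not in [G] but are after adding the top point [p]; those with
   [k <= #|D|] have no completion. *)
Definition missing_traces (n k : nat) (p : 'I_n) (G : {set {set 'I_n}}) : {set {set 'I_n}} :=
  [set D : {set 'I_n} | [&& p \notin D, p |: D \in G, D \notin G & (#|D| < k)%N]]%SET.

Lemma missing_sub (n k m : nat) (mn : (m < n)%N) (G : {set {set 'I_n}}) :
  {in G, forall E : {set 'I_n}, E \subset initial n m.+1} ->
  {in missing_traces k (Ordinal mn) G, forall D : {set 'I_n}, D \subset initial n m}.
Proof.
move=> Gm D; rewrite inE => /and4P[pD /Gm + _ _]; rewrite initialS => /fintype.subsetP h.
apply/fintype.subsetP => i iD; have := h i; rewrite !finset.in_setU1 iD orbT.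
by move=> /(_ isT) /orP[/eqP ip|//]; rewrite -ip iD in pD.
Qed.

(* Two missing traces [D1], [D2] that meet in [t - 1] points must cover [m]: otherwise
   replacing the top point by an uncovered [l] gives two members of [G] meeting in [t - 1]. *)
Lemma missing_inter (n k t m : nat) (mn : (m < n)%N) (G : {set {set 'I_n}}) :
  {in G &, forall A B : {set 'I_n}, (t <= #|A :&: B|)%N} ->
  {in G, forall E : {set 'I_n}, E \subset initial n m.+1} ->
  (forall (l : 'I_n) (D : {set 'I_n}), (l < m)%N -> Ordinal mn \notin D -> l \notin D ->
     Ordinal mn |: D \in G -> l |: D \in G) ->
  {in missing_traces k (Ordinal mn) G &, forall D1 D2 : {set 'I_n},
    (t <= #|D1 :&: D2|)%N \/
    (t <= #|D1 :&: D2|.+1)%N /\ D1 :|: D2 = initial n m}.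
Proof.
set p := Ordinal mn => hG Gm sh D1 D2 D1A D2A.
have D1m := missing_sub Gm D1A; have D2m := missing_sub Gm D2A.
move: D1A D2A; rewrite !inE => /and4P[p1 G1 _ _] /and4P[p2 G2 _ _].
have [E|E] := eqVneq (D1 :|: D2) (initial n m); [right|left].
  split=> //; have := hG _ _ G1 G2; rewrite -finset.setUIr cardsU1 inE (negPf p1) /= add1n.
  by [].
have /fintype.subsetPn[l lm] : ~~ (initial n m \subset D1 :|: D2).
  by apply: contra E => h; rewrite finset.eqEsubset h finset.subUset D1m D2m.
rewrite finset.in_setU negb_or => /andP[l1 l2].
have lp : l != p by rewrite -val_eqE /=; move: lm; rewrite mem_initial; case: ltngtP.
have := hG _ _ (sh l D1 _ p1 l1 G1) G2; rewrite -mem_initial => /(_ lm).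
congr (_ <= _)%N; congr #|pred_of_set _|; apply/setP => i.
rewrite !finset.in_setI !finset.in_setU1; case: eqVneq => [->|_] /=.
  by rewrite (negPf lp) (negPf l1) (negPf l2).
by case: eqVneq => [->|_] //=; rewrite (negPf p1).
Qed.

(** [missing_inter] for [D] and itself: either the size is already at least [t], or [D] is all of
    [m]. *)
Lemma missing_card (n k t m : nat) (mn : (m < n)%N) (G : {set {set 'I_n}}) :
  (t <= m)%N ->
  {in G &, forall A B : {set 'I_n}, (t <= #|A :&: B|)%N} ->
  {in G, forall E : {set 'I_n}, E \subset initial n m.+1} ->
  (forall (l : 'I_n) (D : {set 'I_n}), (l < m)%N -> Ordinal mn \notin D -> l \notin D ->
     Ordinal mn |: D \in G -> l |: D \in G) ->
  {in missing_traces k (Ordinal mn) G, forall D : {set 'I_n}, (t <= #|D|)%N}.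
Proof.
move=> tm hG Gm sh D DA; have := missing_inter hG Gm sh DA DA.
rewrite finset.setIid finset.setUid => -[//|[_ ->]].
by rewrite card_initial // ltnW.
Qed.

(** [G'] consists of the members avoiding [p] (set [B]) and of selected missing traces (set [K]). If
    both [D] and [p |: D] are in [G], [merge] bounds their joint value by the new value of [D]. The
    last clause serves uniqueness: with no gain, no completable trace was discarded. *)
Lemma level_step (R : realType) (n k t m : nat) (mn : (m < n)%N) (x : 'I_n -> R) (b w : R)
    (G : {set {set 'I_n}}) :
  (2 <= t)%N -> (t < k)%N -> large_ground R n k t -> (t <= m)%N ->
  {in G &, forall A B : {set 'I_n}, (t <= #|A :&: B|)%N} ->
  {in G, forall E : {set 'I_n}, E \subset initial n m.+1} ->
  (forall (l : 'I_n) (D : {set 'I_n}), (l < m)%N -> Ordinal mn \notin D -> l \notin D ->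
     Ordinal mn |: D \in G -> l |: D \in G) ->
  admissible k m.+1 x b -> b <= w ->
  w ^+ k = (x (Ordinal mn) ^+ k + (n - m.+1)%:R * b ^+ k) / (n - m.+1).+1%:R ->
  exists G' : {set {set 'I_n}}, [/\ {in G', forall E : {set 'I_n}, E \subset initial n m},
    {in G' &, forall A B : {set 'I_n}, (t <= #|A :&: B|)%N},
    level_val k m.+1 x b G <= level_val k m x w G' &
    (forall i : 'I_n, (i < m)%N -> 0 < x i) -> 0 < w ->
    level_val k m.+1 x b G = level_val k m x w G' ->
    {in G, forall E : {set 'I_n}, (#|E| <= k)%N -> (k <= #|E| + (n - m.+1))%N ->
      E :\ Ordinal mn \in G'}].
Proof.
set p := Ordinal mn => t2 tk hn tm hG Gm sh adm bw wE.
have k0 : (0 < k)%N by exact: leq_ltn_trans tk.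
have x0 := admissible_ge0 adm; have [b0 _ _ _] := adm.
have p0 : 0 <= x p by apply: x0; rewrite /= ltnSn.
have w0 : 0 <= w by exact: le_trans bw.
have nm : (n - m = (n - m.+1).+1)%N by rewrite subnSK.
have xm0 (i : 'I_n) : (i < m)%N -> 0 <= x i by move=> im; apply: x0; exact: ltnW.
pose A := missing_traces k p G; pose B := [set E in G | p \notin E]%SET.
pose v (D : {set 'I_n}) := \prod_(i in D) x i.
pose o d := x p * tailw k (n - m.+1) b d.+1; pose u d := tailw k (n - m) w d.
have hA : {in A, forall D : {set 'I_n}, [/\ D \subset initial n m, (t <= #|D|)%N,
    (#|D| < k)%N & 0 <= v D]}.
  move=> D DA; have Dm := missing_sub Gm DA; split=> //.
  - exact: missing_card DA.
  - by move: DA; rewrite inE => /and4P[].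
  - exact: prod_trace_ge0 Dm.
have merge d : tailw k (n - m.+1) b d + o d <= u d by rewrite /u nm; exact: tailw_merge.
have o0 d : 0 <= o d by rewrite mulr_ge0 ?tailw_ge0.
have hou d : 0 <= o d <= u d.
  by rewrite o0; apply: le_trans (merge d); rewrite lerDr tailw_ge0.
have [n1 n2 n3] := large_ground_nat t2 tk hn.
have hbig d : (t <= d < k)%N -> (m + t <= (2 * d).+1)%N ->
    o d <= (t + 1)%:R^-1 * u d /\ (0 < u d -> o d < (t + 1)%:R^-1 * u d).
  move=> td md; rewrite /o /u nm; apply: tailw_drop_lt => //.
  - by case/andP: td.
  - by rewrite -nm; apply: large_ground_key; rewrite ?tm.
have hsmall d d' : (t <= d)%N -> (d < d' < k)%N -> (d + d').+1 = (m + t)%N ->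
    o d <= 16 / 25 * u d.
  (* From [t <= d] and [d' < k], [2 (k - d) + m <= 3 k - 2 t <= n], so the ratio [(k - d) / (n - m)]
     is at most 1/2. *)
  move=> td dd' dE; have hM : (2 * (k - d) <= n - m)%N by clear - td dd' dE n1 n3; lia.
  rewrite /o /u nm; apply: tailw_drop => //.
  - by clear - dd' hM; lia.
  - apply: ltW; apply: half_power_lt; first by exact: leq_trans tk.
      by rewrite divr_ge0.
    rewrite -nm ler_pdivrMr ?ltr0n ?subn_gt0 // div1r mulrC ler_pdivlMr // -natrM ler_nat.
    by rewrite mulnC.
have [K [KA Kpair Ksum Klt]] := selection t2 tm (ltnW mn) hA hou hbig hsmall.
have KG : [disjoint B & K].
  rewrite finset.disjoints_subset; apply/fintype.subsetP => D; rewrite !inE => /andP[DG _].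
  by apply: contraL DG => /KA; rewrite inE => /and4P[].
have split_le : level_val k m.+1 x b G <=
    \sum_(E in B) v E * u #|E| + \sum_(D in A) v D * o #|D|.
  rewrite /level_val (sum_family_split p).
  have -> : \sum_(D : {set 'I_n} | (p \notin D) && (p |: D \in G))
       (\prod_(i in p |: D) x i) * tailw k (n - m.+1) b #|p |: D| =
     \sum_(D : {set 'I_n} | (p \notin D) && (p |: D \in G)) v D * o #|D|.
    apply: eq_bigr => D /andP[pD _].
    by rewrite big_setU1 //= cardsU1 pD add1n -mulrA mulrCA.
  rewrite [X in _ + X](bigID (fun D => D \in G)) /= addrA; apply: lerD; last first.
    rewrite (bigID (fun D : {set 'I_n} => (#|D| < k)%N)) /= [X in _ + X]big1 ?addr0.
      rewrite le_eqVlt; apply/orP; left; apply/eqP; apply: eq_bigl => D.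
      by rewrite !inE -!andbA.
    by move=> D /andP[_ kD]; rewrite /o tailw_eq0 ?mulr0 // negb_and -ltnNge ltnS leqNgt kD.
  have -> : \sum_(E in G | p \notin E) (\prod_(i in E) x i) * tailw k (n - m.+1) b #|E| =
     \sum_(E in B) v E * tailw k (n - m.+1) b #|E|.
    by apply: eq_bigl => E; rewrite inE.
  have v0 E : E \in B -> 0 <= v E.
    rewrite inE => /andP[/Gm Em _]; exact: prod_trace_ge0 Em.
  apply: (@le_trans _ _ (\sum_(E in B) v E * tailw k (n - m.+1) b #|E| +
    \sum_(E in B) v E * o #|E|)).
    rewrite lerD2l big_mkcond [leRHS]big_mkcond /=; apply: ler_sum => D _.
    have [DB|DB] := boolP (D \in B).
      by case: ifP => // _; rewrite mulr_ge0 ?v0.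
    case: ifP => // /andP[/andP[pD _] DG]; move: DB.
    by rewrite inE pD DG.
  rewrite -big_split /=; apply: ler_sum => E /v0 vE.
  by rewrite -mulrDr ler_wpM2l.
have valG' : level_val k m x w (B :|: K) =
    \sum_(E in B) v E * u #|E| + \sum_(D in K) v D * u #|D|.
  by rewrite /level_val -bigU //=; apply: eq_bigl => E; rewrite finset.in_setU.
exists (B :|: K); split.
- move=> E /setUP[|/KA /hA[] //]; rewrite inE => /andP[/Gm Em pE].
  rewrite -(initialD1 mn) finset.subsetD1 Em; exact: pE.
- have BK E D : E \in B -> D \in K -> (t <= #|E :&: D|)%N.
    rewrite inE => /andP[EG pE] /KA; rewrite inE => /and4P[pD DG _ _].
    have := hG _ _ EG DG; congr (_ <= _)%N; congr #|pred_of_set _|; apply/setP => i.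
    rewrite !finset.in_setI finset.in_setU1; case: eqVneq => [->|_] //=.
    by rewrite (negPf pE).
  move=> E F /setUP[EB|EK] /setUP[FB|FK].
  + by move: EB FB; rewrite !inE => /andP[EG _] /andP[FG _]; exact: hG.
  + exact: BK.
  + by rewrite finset.setIC; exact: BK.
  + have [//|[h1 h2]] := missing_inter hG Gm sh (KA _ EK) (KA _ FK).
    (* Meeting in [t - 1] points while covering [m] would give sizes with sum [m + t - 1], which
       [Kpair] forbids. *)
    rewrite leqNgt; apply/negP => h3.
    have := Kpair _ _ EK FK; rewrite h2 eqxx => h; suff: false by [].
    apply: h; rewrite -cardsUI h2 card_initial ?(ltnW mn) // -addnS; congr (_ + _)%N.
    by apply/eqP; rewrite eqn_leq h1 andbT.
- by apply: le_trans split_le _; rewrite valG' lerD2l.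
- move=> xp wp eqG E EG Ek kE; rewrite finset.in_setU.
  have [pE|pE] := boolP (p \in E); last first.
    apply/orP; left; suff -> : E :\ p = E by rewrite inE EG.
    by apply/setP => i; rewrite finset.in_setD1; case: eqVneq => [->|//]; rewrite (negPf pE).
  have cE : #|E| = #|E :\ p|.+1 by rewrite (cardsD1 p) pE add1n.
  have pD : p \notin E :\ p by rewrite finset.setD11.
  have [DG|DG] := boolP (E :\ p \in G); first by rewrite inE DG pD.
  apply/orP; right; apply: contraTT isT => DK.
  have DA : E :\ p \in A.
    by rewrite inE pD finset.setD1K // EG DG -cE.
  have [Dm _ Dk _] := hA _ DA.
  have := Klt _ DA DK (prod_trace_gt0 xp Dm).
  have : 0 < u #|E :\ p|.
    apply: tailw_gt0 => //; first exact: ltnW.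
    by rewrite nm addnS -addSn -cE.
  move=> u1 /(_ u1) lt_K.
  have : level_val k m.+1 x b G < level_val k m x w (B :|: K).
    by apply: le_lt_trans split_le _; rewrite valG' ltrD2l.
  by rewrite eqG ltxx.
Qed.

(** * Compressing traces at a fixed level *)

Lemma swap_setU1D1 (T : finType) (i j : T) (E : {set T}) :
  j \in E -> i \notin E -> swap_set i j E = i |: (E :\ j).
Proof.
move=> jE iE; apply/setP => l; rewrite mem_swap_set finset.in_setU1 finset.in_setD1.
case: tpermP => [->|->|/eqP li /eqP lj]; first by rewrite eqxx jE.
  by rewrite eqxx /= orbF (negPf iE); case: eqVneq => // ji; rewrite ji (negPf iE) in jE.
by rewrite (negPf li) lj.
Qed.

Lemma big_swap_set (T : finType) (R : Type) (idx : R) (op : Monoid.com_law idx) (i j : T)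
    (E : {set T}) (f : T -> R) : j \in E -> i \notin E ->
  \big[op/idx]_(l in swap_set i j E) f l = op (f i) (\big[op/idx]_(l in E :\ j) f l).
Proof.
move=> jE iE; rewrite swap_setU1D1 // big_setU1 //.
by rewrite finset.in_setD1 (negPf iE) andbF.
Qed.

Lemma swap_set_initial (n m : nat) (i j : 'I_n) (E : {set 'I_n}) :
  (i < m)%N -> (j < m)%N -> (swap_set i j E \subset initial n m) = (E \subset initial n m).
Proof.
move=> im jm; suff h (F : {set 'I_n}) :
    F \subset initial n m -> swap_set i j F \subset initial n m.
  by apply/idP/idP => /h //; rewrite swap_setK.
move=> /subset_initialP Fm; apply/subset_initialP => l; rewrite mem_swap_set.
by case: tpermP => [->|->|_ _ /Fm].
Qed.

Section Shift.
Variables (R : realFieldType) (n k m : nat) (x : 'I_n -> R) (b : R) (i j : 'I_n).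
Hypotheses (ij : (i < j)%N) (jm : (j < m)%N) (adm : admissible k m x b).

Let im : (i < m)%N. Proof. exact: ltn_trans jm. Qed.

(** Extended by 0, because [shift_sum_le] asks for monotonicity on all sets while [x] is controlled
    only on [m]. *)
Let weight (E : {set 'I_n}) : R :=
  if E \subset initial n m then (\prod_(l in E) x l) * tailw k (n - m) b #|E| else 0.

Let level_valE (G : {set {set 'I_n}}) :
  {in G, forall E : {set 'I_n}, E \subset initial n m} ->
  level_val k m x b G = \sum_(E in G) weight E.
Proof. by move=> Gm; apply: eq_bigr => E /Gm Em; rewrite /weight Em. Qed.

Let weight_le (E : {set 'I_n}) : j \in E -> i \notin E -> weight E <= weight (swap_set i j E).
Proof.
move=> jE iE; rewrite /weight swap_set_initial // card_swap_set; case: ifP => // Em.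
have [b0 _ xs _] := adm.
rewrite ler_wpM2r ?tailw_ge0 // big_swap_set // (big_setD1 j) //= ler_wpM2r //; last first.
  by apply: xs jm; exact: ltnW.
apply: prod_trace_ge0 (admissible_ge0 adm) _.
by apply: fintype.subset_trans Em; exact: finset.subD1set.
Qed.

Lemma shift_family_initial (G : {set {set 'I_n}}) :
  {in G, forall E : {set 'I_n}, E \subset initial n m} ->
  {in shift_family i j G, forall E : {set 'I_n}, E \subset initial n m}.
Proof.
move=> Gm E; rewrite inE; case: ifP => _; first by case/andP => /Gm.
by case/orP => /Gm //; rewrite swap_set_initial.
Qed.

Lemma level_val_shift_le (G : {set {set 'I_n}}) :
  {in G, forall E : {set 'I_n}, E \subset initial n m} ->
  level_val k m x b G <= level_val k m x b (shift_family i j G).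
Proof.
move=> Gm; rewrite !level_valE //; last exact: shift_family_initial.
exact: shift_sum_le.
Qed.

Lemma level_val_shift_lt (G : {set {set 'I_n}}) (E : {set 'I_n}) :
  {in G, forall E : {set 'I_n}, E \subset initial n m} ->
  E \in G -> j \in E -> i \notin E -> swap_set i j E \notin G ->
  (forall l : 'I_n, (l < m)%N -> 0 < x l) -> x j < x i -> 0 < tailw k (n - m) b #|E| ->
  level_val k m x b G < level_val k m x b (shift_family i j G).
Proof.
move=> Gm EG jE iE sE x0 xij T0; rewrite !level_valE //; last exact: shift_family_initial.
apply: (shift_sum_lt weight_le EG) => //; have Em := Gm _ EG.
rewrite /weight swap_set_initial // Em card_swap_set ltr_pM2r // big_swap_set //.
rewrite (big_setD1 j) //= ltr_pM2r //; apply: prod_trace_gt0 x0 _.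
by apply: fintype.subset_trans Em; exact: finset.subD1set.
Qed.

End Shift.

(** A termination measure for repeated compression. *)
Definition potential (n : nat) (G : {set {set 'I_n}}) : nat :=
  (\sum_(E in G) \sum_(i in E) i)%N.

(** [shift_sum_lt] for the negated element sums, which a swap from [j] to the smaller [i]
    increases. *)
Lemma potential_shift (n : nat) (i j : 'I_n) (G : {set {set 'I_n}}) (E : {set 'I_n}) :
  (i < j)%N -> E \in G -> j \in E -> i \notin E -> swap_set i j E \notin G ->
  (potential (shift_family i j G) < potential G)%N.
Proof.
move=> ij EG jE iE sE; pose w (E : {set 'I_n}) : int := - (\sum_(i in E) i)%N%:Z.
have w_lt (F : {set 'I_n}) : j \in F -> i \notin F -> w F < w (swap_set i j F).
  by move=> jF iF; rewrite /w ltrN2 ltz_nat big_swap_set // (big_setD1 (A := F) j) //= ltn_add2r.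
have potE H : (potential H)%:Z = - \sum_(E in H) w E.
  by rewrite sumrN opprK /potential -[LHS]natz natr_sum; apply: eq_bigr => F _; rewrite natz.
rewrite -ltz_nat !potE ltrN2; apply: (@shift_sum_lt _ _ i j w G E) => //; last exact: w_lt.
by move=> F jF iF; exact/ltW/w_lt.
Qed.

(** * Induction over the levels *)

(** Members that cannot be completed to size [k] have value 0, so only the completable ones must
    contain the centre. *)
Lemma level_val_star_ge (R : realFieldType) (n k t m : nat) (x : 'I_n -> R) (b : R)
    (G : {set {set 'I_n}}) :
  admissible k m x b -> {in G, forall E : {set 'I_n}, E \subset initial n m} ->
  {in G, forall E : {set 'I_n}, (#|E| <= k)%N -> (k <= #|E| + (n - m))%N ->
    initial n t \subset E} ->
  level_val k m x b G <= level_val k m x b (star_trace n m t).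
Proof.
move=> adm Gm Gt; rewrite /level_val big_mkcond [leRHS]big_mkcond /=.
have [b0 _ _ _] := adm; apply: ler_sum => E _.
have w0 : E \subset initial n m -> 0 <= (\prod_(i in E) x i) * tailw k (n - m) b #|E|.
  by move=> Em; rewrite mulr_ge0 ?tailw_ge0 // (prod_trace_ge0 (admissible_ge0 adm) Em).
case: ifP => EG; last first.
  by case: ifP => // /[!inE] /andP[_ /w0].
have Em := Gm _ EG; case: ifP => // nS.
have [/andP[h1 h2]|h] := boolP (#|E| <= k <= #|E| + (n - m))%N.
  by move: nS; rewrite inE Em (Gt _ EG).
by rewrite tailw_eq0 ?mulr0.
Qed.

(** Outer induction on [m - t], inner induction on [potential] until no compression changes the
    family, as [level_step] requires. The equality clause speaks of completable members because the
    others have value 0. *)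
Lemma level_bound (R : realType) (n k t m : nat) :
  (2 <= t)%N -> (t < k)%N -> large_ground R n k t -> (t <= m <= n)%N ->
  forall (x : 'I_n -> R) (b : R) (G : {set {set 'I_n}}), admissible k m x b ->
  {in G, forall E : {set 'I_n}, E \subset initial n m} ->
  {in G &, forall A B : {set 'I_n}, (t <= #|A :&: B|)%N} ->
  level_val k m x b G <= star_val R n k t /\
  (level_val k m x b G = star_val R n k t ->
   {in G, forall E : {set 'I_n}, (#|E| <= k)%N -> (k <= #|E| + (n - m))%N ->
     initial n t \subset E}).
Proof.
move=> t2 tk hn /andP[tm]; have [_ kn _] := large_ground_nat t2 tk hn.
have k1 : (1 < k)%N by exact: ltn_trans tk.
have tn : (t <= n)%N by exact: leq_trans (ltnW tk) (ltnW kn).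
have tv (q : nat) (x : 'I_n -> R) (b : R) (G : {set {set 'I_n}}) :
    (t <= q <= n)%N -> admissible k q x b ->
    {in G, forall E : {set 'I_n}, E \subset initial n q} ->
    level_val k q x b G = star_val R n k t ->
    {in G, forall E : {set 'I_n}, (#|E| <= k)%N -> (k <= #|E| + (n - q))%N ->
      initial n t \subset E} -> two_valued t q x b.
  move=> qn adm Gm eqG Gt; have [h1 h2] := star_level k1 tk kn qn adm.
  by apply: h2; apply/eqP; rewrite eq_le h1 -eqG level_val_star_ge.
rewrite -(subnKC tm); elim: (m - t)%N => {m tm} [|e IH].
  rewrite addn0 => _ x b G adm Gm hG.
  have Gt : {in G, forall E : {set 'I_n}, initial n t \subset E}.
    move=> E EG; have := hG _ _ EG EG; rewrite finset.setIid => tE.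
    suff -> : E = initial n t by [].
    by apply/eqP; rewrite finset.eqEcard Gm // card_initial.
  split=> [|_ E EG _ _]; last exact: Gt.
  have [h1 _] := star_level k1 tk kn (introT andP (conj (leqnn t) tn)) adm.
  by apply: le_trans h1; apply: level_val_star_ge => // E EG _ _; exact: Gt.
rewrite addnS; set m := (t + e)%N in IH *; move=> mn x b G adm.
have tm : (t <= m)%N by exact: leq_addr.
have [c Gc] : {c | (potential G < c)%N} by exists (potential G).+1.
elim: c G Gc => [//|c IHc] G Gc Gm hG.
have [[i [j [E [ij jm [EG jE iE sE]]]]]|stable] := pselect (exists (i j : 'I_n) (E : {set 'I_n}),
    [/\ (i < j)%N, (j < m.+1)%N & [/\ E \in G, j \in E, i \notin E & swap_set i j E \notin G]]).
  have im : (i < m.+1)%N by exact: ltn_trans jm.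
  have pot := potential_shift ij EG jE iE sE.
  have [h1 h2] := IHc (shift_family i j G) (leq_trans pot Gc)
    (shift_family_initial ij jm Gm) (shift_family_intersecting hG).
  have le_sh := level_val_shift_le ij jm adm Gm.
  split=> [|eqG]; first exact: le_trans h1.
  have eqS : level_val k m.+1 x b (shift_family i j G) = star_val R n k t.
    by apply/eqP; rewrite eq_le h1 -eqG.
  have tvS := tv m.+1 _ _ _ (introT andP (conj (leqW tm) mn)) adm
    (shift_family_initial ij jm Gm) eqS (h2 eqS).
  have x0 := two_valued_gt0 tvS; case: tvS => b0 [b00 xb xc bc].
  move=> F FG Fk kF; have [FS|FS] := boolP (F \in shift_family i j G).
    exact: h2 eqS _ FS Fk kF.
  (* [F] was removed by the compression, so its swap replaced it and contains the centre. If [i] and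
     [j] both lie off the centre, so does [F] contain it; if [i < t <= j], then [x j < x i] and the
     compression would have gained strictly. *)
  move: FS; rewrite inE FG /=; case: ifP => // /andP[jF iF] sF.
  have sFS : swap_set i j F \in shift_family i j G.
    rewrite inE swap_setK FG orbT !mem_swap_set tpermL tpermR jF.
    by rewrite (negPf iF).
  have tF : initial n t \subset swap_set i j F.
    by apply: h2 eqS _ sFS _ _; rewrite card_swap_set.
  have tj : (t <= j)%N.
    rewrite leqNgt; apply/negP => jt; have := fintype.subsetP tF j.
    by rewrite mem_initial jt mem_swap_set tpermR (negPf iF) => /(_ isT).
  have [ti|it] := leqP t i.
    apply/fintype.subsetP => l lt; have := fintype.subsetP tF l lt.
    rewrite mem_swap_set tpermD // -val_eqE /=; apply/eqP => h; move: lt.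
      by rewrite mem_initial -h ltnNge ti.
    by rewrite mem_initial -h ltnNge tj.
  have : level_val k m.+1 x b G < level_val k m.+1 x b (shift_family i j G).
    apply: (level_val_shift_lt ij jm adm Gm FG) => //; first by rewrite (xc j) // xb.
    apply: tailw_gt0 => // nm; rewrite bc // -subn_gt0; exact: nm.
  by rewrite eqG eqS ltxx.
set p := Ordinal mn.
have sh (l : 'I_n) (D : {set 'I_n}) : (l < m)%N -> p \notin D -> l \notin D ->
    p |: D \in G -> l |: D \in G.
  move=> lm pD lD pG; apply/negPn/negP => lG; apply: stable.
  have lp : l != p by rewrite -val_eqE /= ltn_eqF.
  have lpD : l \notin p |: D by rewrite finset.in_setU1 negb_or lp.
  exists l, p, (p |: D); split=> //=; split=> //; first by rewrite finset.setU11.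
  by rewrite swap_setU1D1 ?finset.setU11 // finset.setU1K.
have [w [bw wp wE admw]] := admissible_merge mn (ltnW k1) adm.
have [G' [Gm' hG' le1 hE]] := level_step t2 tk hn tm hG Gm sh adm bw wE.
have [h1 h2] := IH (ltnW mn) x w G' admw Gm' hG'.
split=> [|eqG]; first exact: le_trans h1.
have eqG' : level_val k m x w G' = star_val R n k t by apply/eqP; rewrite eq_le h1 -eqG.
have tv' := tv m _ _ _ (introT andP (conj tm (ltnW mn))) admw Gm' eqG' (h2 eqG').
move=> E EG Ek kE.
have w0 : 0 < w by case: tv' => c0 [c00 _ _ ->].
have EG' := hE (two_valued_gt0 tv') w0 (etrans eqG (esym eqG')) E EG Ek kE.
(* Removing [p] costs at most one point while the tail gains one, so [E :\ p] stays completable. *)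
have cE : #|E| = ((p \in E) + #|E :\ p|)%N by exact: cardsD1.
apply: (@fintype.subset_trans _ _ (mem (E :\ p))); last exact: finset.subD1set.
apply: h2 eqG' _ EG' _ _; first by apply: leq_trans Ek; rewrite cE leq_addl.
by apply: (leq_trans kE); rewrite cE -(subnSK mn) addnS -addnA -[leqRHS]add1n leq_add2r leq_b1.
Qed.

(** * Arbitrary weights and families *)

Lemma sort_weights (R : realType) (n : nat) (y : 'I_n -> R) :
  exists s : {perm 'I_n}, forall i j : 'I_n, (i <= j)%N -> y (s j) <= y (s i).
Proof.
pose r := [rel a b : R | b <= a].
have r_tr : transitive r by move=> a b c /= ba cb; exact: le_trans cb ba.
have r_tot : total r by move=> a b /=; exact: le_total.
pose T := [tuple y i | i < n].
have /tuple_permP[s sE] : perm_eq (sort r T) T by rewrite perm_sort.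
exists s => i j ij; have st : sorted r (sort r T) by exact: sort_sorted.
have nthE (l : 'I_n) : nth 0 (sort r T) l = y (s l).
  rewrite sE; have := tnth_nth 0 [tuple tnth T (s l0) | l0 < n] l.
  by rewrite !tnth_mktuple => <-.
have sz : size (sort r T) = n by rewrite size_sort size_tuple.
rewrite -!nthE; case: (ltngtP i j) ij => // [ij _|/val_inj -> _]; last exact: lexx.
by have := sorted_ltn_nth r_tr 0 st; apply; rewrite ?inE ?sz.
Qed.

Lemma level_val_uniform (R : realFieldType) (n k : nat) (x : 'I_n -> R) (b : R)
    (G : {set {set 'I_n}}) : k_uniform k G ->
  level_val k n x b G = \sum_(A in G) \prod_(i in A) x i.
Proof.
move=> Gk; apply: eq_bigr => A /Gk Ak.
by rewrite /tailw Ak leqnn !subnn bin0 expr0 !mulr1.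
Qed.

(** [star_trace] does not fix the size; at level [n] the factor [tailw] is 1 on size [k] and 0 on
    all others, which selects the full star. *)
Lemma level_val_full_star (R : realFieldType) (n k t : nat) (x : 'I_n -> R) (b : R) :
  level_val k n x b (star_trace n n t) = \sum_(A in full_star n k t) \prod_(i in A) x i.
Proof.
rewrite /level_val big_mkcond [RHS]big_mkcond /=; apply: eq_bigr => A _.
have An : A \subset initial n n by apply/subset_initialP => i _.
rewrite !inE An andbT /initial; case: ifP => // _; rewrite ?andbF // andbT.
case: eqP => [->|/eqP Ak]; first by rewrite /tailw leqnn !subnn bin0 expr0 !mulr1.
by rewrite tailw_eq0 ?mulr0 // subnn addn0 -eqn_leq.
Qed.

(** The optimal weights are constant off the centre, so Pascal's rule carries the value unchanged
    from level [t] to level [n]. *)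
Lemma star_attained (R : realType) (n k t : nat) : (t < k)%N -> (k < n)%N ->
  exists2 y : 'rV[R]_n, unit_weights R n k y &
    \sum_(A in full_star n k t) \prod_(i in A) y ord0 i = star_val R n k t.
Proof.
move=> tk kn; have k0 : (0 < k)%N by exact: leq_ltn_trans tk.
have tn : (t <= n)%N by exact: leq_trans (ltnW tk) (ltnW kn).
set al := star_head R k; set be := star_tail R n k t.
pose y : 'rV[R]_n := \row_i (if (i < t)%N then al else be).
have yE (i : 'I_n) : y ord0 i = if (i < t)%N then al else be by rewrite mxE.
exists y.
  split=> [i|]; first by rewrite yE; case: ifP => _; exact: powR_ge0.
  rewrite (bigID (fun i => i \in initial n t)) /=.
  rewrite (eq_bigr (fun=> al ^+ k)); last by move=> i; rewrite mem_initial yE => ->.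
  rewrite [X in _ + X](eq_bigr (fun=> be ^+ k)); last first.
    by move=> i; rewrite mem_initial yE => /negPf ->.
  rewrite !sumr_const card_initial // star_headX // star_tailX //.
  set c := #|_|; have -> : c = (n - t)%N.
    have h := cardC (mem (initial n t)); rewrite card_initial // card_ord in h.
    by rewrite -[in RHS]h addKn.
  rewrite -[_ *+ t]mulr_natl -[_ *+ (n - t)]mulr_natl (natrB _ (ltnW tk)).
  by field; rewrite !pnatr_eq0 -!lt0n subn_gt0 k0 (ltn_trans tk).
have step e : (t + e <= n)%N ->
    level_val k (t + e) (fun i => y ord0 i) be (star_trace n (t + e) t) = star_val R n k t.
  elim: e => [_|e IH]; rewrite ?addn0 ?addnS.
    rewrite level_val_star_base // ?(ltnW tk) // /star_val; congr (_ * _ * _).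
    rewrite (eq_bigr (fun=> al)) ?prodr_const ?card_initial // => i.
    by rewrite mem_initial yE => ->.
  move=> en; rewrite -(IH (ltnW en)) (level_val_star_step k en) ?leq_addr //.
  apply: eq_bigr => D _; rewrite yE /= ltnNge leq_addr /=.
  by rewrite -tailw_pascal subnSK.
by rewrite -(level_val_full_star _ _ _ be) -(step (n - t)%N) subnKC.
Qed.

Lemma permute_familyK (n : nat) (s : {perm 'I_n}) (F : {set {set 'I_n}}) :
  permute_family s (permute_family s^-1%g F) = F.
Proof.
have sK (A : {set 'I_n}) : (s @: (s^-1%g @: A) = A)%SET.
  by rewrite -imset_comp -[RHS]imset_id; apply: eq_imset => i /=; rewrite permKV.
apply/setP => A; apply/imsetP/idP => [[B /imsetP[C CF ->] ->]|AF].
  by rewrite sK.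
exists (s^-1%g @: A)%SET; last by rewrite sK.
by apply/imsetP; exists A.
Qed.

Lemma card_permute (n : nat) (s : {perm 'I_n}) (A : {set 'I_n}) :
  #|(s @: A)%SET| = #|A|.
Proof. by rewrite card_imset //; exact: perm_inj. Qed.

Lemma uniform_permute (n k : nat) (s : {perm 'I_n}) (F : {set {set 'I_n}}) :
  k_uniform k F -> k_uniform k (permute_family s F).
Proof. by move=> Fk _ /imsetP[A AF ->]; rewrite card_permute; exact: Fk. Qed.

Lemma intersecting_permute (n t : nat) (s : {perm 'I_n}) (F : {set {set 'I_n}}) :
  t_intersecting t F -> t_intersecting t (permute_family s F).
Proof.
move=> Ft _ _ /imsetP[A AF ->] /imsetP[B BF ->].
rewrite -imsetI; last by move=> i j _ _; exact: perm_inj.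
by rewrite card_permute; exact: Ft.
Qed.

Lemma sum_permute (R : comPzSemiRingType) (n : nat) (s : {perm 'I_n}) (F : {set {set 'I_n}})
    (y : 'I_n -> R) :
  \sum_(A in permute_family s^-1 F) \prod_(i in A) y (s i) = \sum_(A in F) \prod_(i in A) y i.
Proof.
rewrite big_imset /=; last by move=> A B _ _; apply: imset_inj; exact: perm_inj.
apply: eq_bigr => A _; rewrite big_imset /=; last by move=> i j _ _; exact: perm_inj.
by apply: eq_bigr => i _; rewrite permKV.
Qed.

Lemma star_bound (R : realType) (n k t : nat) (F : {set {set 'I_n}}) (y : 'rV[R]_n) :
  (2 <= t)%N -> (t < k)%N -> large_ground R n k t ->
  k_uniform k F -> t_intersecting t F -> unit_weights R n k y ->
  \sum_(A in F) \prod_(i in A) y ord0 i <= star_val R n k t /\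
  (\sum_(A in F) \prod_(i in A) y ord0 i = star_val R n k t ->
   exists s : {perm 'I_n}, F = permute_family s (full_star n k t)).
Proof.
move=> t2 tk hn Fk Ft [y0 y1]; have [_ kn _] := large_ground_nat t2 tk hn.
have k1 : (1 < k)%N by exact: ltn_trans tk.
have tn : (t <= n <= n)%N by rewrite leqnn (leq_trans (ltnW tk)) // ltnW.
have [s sP] := sort_weights (fun i => y ord0 i).
pose x (i : 'I_n) := y ord0 (s i); pose G := permute_family s^-1%g F.
have Gk : k_uniform k G by exact: uniform_permute.
have Gt : t_intersecting t G by exact: intersecting_permute.
have Gn : {in G, forall E : {set 'I_n}, E \subset initial n n}.
  by move=> E _; apply/subset_initialP => i _.
(* No point lies outside level [n]; the value 0 for its common weight is below all weights. *)
have adm : admissible k n x 0.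
  split=> // [i _|i j ij _|]; [exact: y0|exact: sP|].
  rewrite subnn mul0r addr0 -[RHS]y1 [RHS](reindex_inj (@perm_inj _ s)) /=.
  by apply: eq_bigl => i; rewrite mem_initial ltn_ord.
have valE : \sum_(A in F) \prod_(i in A) y ord0 i = level_val k n x 0 G.
  by rewrite level_val_uniform // -(sum_permute s).
rewrite valE; have [h1 h2] := level_bound t2 tk hn tn adm Gn Gt.
split=> // eqG; have tG := h2 eqG.
have {}tG : {in G, forall E : {set 'I_n}, initial n t \subset E}.
  by move=> E EG; apply: tG => //; rewrite Gk // leq_addr.
have [s1 s2] := star_level k1 tk kn tn adm.
have GS : {subset G <= star_trace n n t}.
  by move=> E EG; rewrite inE tG ?Gn.
have leS : level_val k n x 0 G <= level_val k n x 0 (star_trace n n t).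
  by apply: level_val_star_ge => // E EG _ _; exact: tG.
have eqS : level_val k n x 0 (star_trace n n t) = star_val R n k t.
  by apply/eqP; rewrite eq_le s1 -eqG.
(* All weights are positive, so a star member absent from [G] would make the value of [G] strictly
   smaller. *)
have x0 := two_valued_gt0 (s2 eqS).
suff GE : G = full_star n k t by exists s; rewrite -GE permute_familyK.
have sub : G \subset full_star n k t.
  by apply/fintype.subsetP => A AG; rewrite inE Gk // eqxx; exact: tG.
apply/eqP; rewrite finset.eqEsubset sub /=; apply/fintype.subsetP => B BS.
apply: contraT => BG; suff : level_val k n x 0 G < star_val R n k t by rewrite eqG ltxx.
rewrite -eqS level_val_full_star level_val_uniform // [ltRHS](big_setID G) /= finset.setIC.
rewrite (finset.setIidPl sub) ltrDl (big_setD1 B) ?finset.in_setD ?BG //=.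
have pos (A : {set 'I_n}) : 0 < \prod_(i in A) x i by apply: prodr_gt0 => i _; exact: x0.
by apply: ltr_wpDr (pos _); apply: sumr_ge0 => A _; exact/ltW/pos.
Qed.

(** * The spectral radius *)

(** The radius is attained by [rho_max], so both the bound and its equality case are read off at a
    maximizer. *)
Lemma rho_le (R : realType) (n k t : nat) (F : {set {set 'I_n}}) :
  (2 <= t)%N -> (t < k)%N -> large_ground R n k t ->
  k_uniform k F -> t_intersecting t F ->
  rho R k F <= k%:R * star_val R n k t /\
  (rho R k F = k%:R * star_val R n k t ->
   exists s : {perm 'I_n}, F = permute_family s (full_star n k t)).
Proof.
move=> t2 tk hn Fk Ft; have [_ kn _] := large_ground_nat t2 tk hn.
have k0 : (0 < k)%N by exact: leq_ltn_trans tk.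
have n0 : (0 < n)%N by exact: leq_ltn_trans kn.
have [[y yu <-] _] := rho_max R F n0 k0.
have [h1 h2] := star_bound t2 tk hn Fk Ft yu.
have kR : (0 : R) < k%:R by rewrite ltr0n.
rewrite /family_poly; split; first by rewrite ler_pM2l.
by move/(mulfI (lt0r_neq0 kR)).
Qed.

Lemma full_star_uniform (n k t : nat) : k_uniform k (full_star n k t).
Proof. by move=> A; rewrite inE => /andP[/eqP]. Qed.

Lemma full_star_intersecting (n k t : nat) : (t <= n)%N ->
  t_intersecting t (full_star n k t).
Proof.
move=> tn A B; rewrite !inE => /andP[_ tA] /andP[_ tB].
by rewrite -{1}(card_initial tn) subset_leq_card // finset.subsetI tA.
Qed.

Lemma rho_full_star (R : realType) (n k t : nat) :
  (2 <= t)%N -> (t < k)%N -> large_ground R n k t ->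
  rho R k (full_star n k t) = k%:R * star_val R n k t.
Proof.
move=> t2 tk hn; have [_ kn _] := large_ground_nat t2 tk hn.
have k0 : (0 < k)%N by exact: leq_ltn_trans tk.
have n0 : (0 < n)%N by exact: leq_ltn_trans kn.
have tn : (t <= n)%N by exact: leq_trans (ltnW tk) (ltnW kn).
have [h _] := rho_le t2 tk hn (@full_star_uniform n k t) (full_star_intersecting tn).
apply/eqP; rewrite eq_le h /=.
have [_ rmax] := rho_max R (full_star n k t) n0 k0.
have [y yu <-] := star_attained R tk kn.
exact: rmax.
Qed.
Unset Implicit Arguments.

Theorem corollary1p2 (R : realType) (n k t : nat)
    (ht : (2 <= t)%N) (htk : (t < k)%N)
    (hn : ((t + 1) * (k - t + 1))%N%:Z
            + Num.ceil ((t + 1)%N%:R * ln (t + 1)%N%:R : R) <= n%:Z) :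
  spectrally_extremal R k t (full_star n k t) /\
  forall F : {set {set 'I_n}}, spectrally_extremal R k t F ->
    exists s : {perm 'I_n}, F = permute_family s (full_star n k t).
Proof.
have large : large_ground R n k t.
  rewrite /large_ground -[n%:R]/((n%:Z)%:~R); apply: (@le_trans _ _
    ((((t + 1) * (k - t + 1))%N%:Z + Num.ceil ((t + 1)%N%:R * ln (t + 1)%N%:R : R))%:~R)).
    by rewrite intrD lerD2l ceil_ge.
  by rewrite ler_int.
have [_ kn _] := large_ground_nat ht htk large.
have tn : (t <= n)%N by exact: leq_trans (ltnW htk) (ltnW kn).
have starE := rho_full_star ht htk large.
have star_ext : spectrally_extremal R k t (full_star n k t).
  split; [exact: full_star_uniform|exact: full_star_intersecting|].
  by move=> G Gk Gt; rewrite starE; case: (rho_le ht htk large Gk Gt).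
split=> // F [Fk Ft Fmax]; have [h1 h2] := rho_le ht htk large Fk Ft.
apply: h2; apply/eqP; rewrite eq_le h1 -starE.
by case: star_ext => Sk St _; exact: Fmax.
Qed.
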